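(* A $3$-choosable-critical graph is $(4:2)$-choosable if and only if it is one of the following: (a) two vertex-disjoint even cycles joined by a path, (b) two even cycles with exactly one vertex in common, (c) a $\Theta_{2,2s,2t}$-graph or $\Theta_{1, 2s-1, 2t-1}$-graph with $s,t > 1$, (d) $\Theta_{2,2,2,2}$.
   Context: A graph $G$ is $(a:b)$-choosable if for every list assignment $L$ with $|L(v)| = a$ for all $v$, there is a $b$-tuple $L$-colouring of $G$, i.e. a function $f$ assigning to each vertex $v$ a set $f(v)\subseteq L(v)$ of $b$ colours with $f(u)\cap f(v)=\emptyset$ for every edge $uv$. A $(a:1)$-choosable graph is called $a$-choosable. A graph is $3$-choosable-critical if it is not $2$-choosable but every proper subgraph is $2$-choosable. $\Theta_{r,s,t}$ denotes the graph consisting of two end vertices joined by three internally vertex-disjoint paths with $r$, $s$, $t$ edges respectively; $\Theta_{2,2,2,2t}$ analogously has four such paths with $2,2,2,2t$ edges. *)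

(* Defs.v *)
From mathcomp Require Import all_boot.

Set Implicit Arguments.
Unset Strict Implicit.
Unset Printing Implicit Defensive.

Record sgraph := SGraph {
  vertex :> finType;
  edge : rel vertex;
  edge_sym : symmetric edge;
  edge_irr : irreflexive edge }.

Record subgraph (G : sgraph) := Subgraph {
  sub_verts : {set G};
  sub_edge : rel G;
  sub_edge_sym : symmetric sub_edge;
  sub_edgeP : forall x y,
    sub_edge x y -> [&& x \in sub_verts, y \in sub_verts & edge x y] }.

Section GraphOfSubgraph.
Variables (G : sgraph) (H : subgraph G).

Definition graph_sub_edge : rel {x : G | x \in sub_verts H} :=
  fun x y => sub_edge H (val x) (val y).

Lemma graph_sub_edge_sym : symmetric graph_sub_edge.
Proof. by move=> x y; apply: sub_edge_sym. Qed.

Lemma graph_sub_edge_irr : irreflexive graph_sub_edge.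
Proof.
move=> x; apply/negbTE/negP => /sub_edgeP /and3P[_ _].
by rewrite edge_irr.
Qed.

Definition graph_of_subgraph : sgraph :=
  SGraph graph_sub_edge_sym graph_sub_edge_irr.

End GraphOfSubgraph.

Definition proper_subgraph (G : sgraph) (H : subgraph G) : Prop :=
  sub_verts H != [set: G] \/ exists x y : G, edge x y /\ ~~ sub_edge H x y.

(* Since G is finite, only finitely many colours occur in its lists, so it
   loses no generality to let the palette C range over finite types. *)
Definition choosable (a b : nat) (G : sgraph) : Prop :=
  forall (C : finType) (L : G -> {set C}), (forall v, #|L v| = a) ->
  exists f : G -> {set C},
    (forall v, f v \subset L v /\ #|f v| = b) /\
    (forall u v, edge u v -> f u :&: f v = set0).

Definition choosable1 (a : nat) (G : sgraph) : Prop := choosable a 1 G.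

Definition three_choosable_critical (G : sgraph) : Prop :=
  ~ choosable1 2 G /\
  forall H : subgraph G, proper_subgraph H ->
    choosable1 2 (graph_of_subgraph H).

(* x and y are consecutive, in either order, in the vertex sequence w. *)
Definition walk_edge (T : eqType) (w : seq T) : rel T :=
  fun x y => infix [:: x; y] w || infix [:: y; x] w.

(* G has exactly the vertices and the edges of the walks in ws. *)
Definition union_of_walks (G : sgraph) (ws : seq (seq G)) : Prop :=
  (forall x : G, has (fun w => x \in w) ws) /\
  (forall x y : G, edge x y = has (fun w => walk_edge w x y) ws).

(* The even cycle through x is the closed walk x, c, x of length
   (size c).+1; simplicity of c is imposed by the uniq conditions below. *)
Definition even_cycle_length (T : Type) (c : seq T) : bool :=
  (2 < (size c).+1) && ~~ odd (size c).+1.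

(* p is the sequence of inner vertices of the connecting path, which has
   (size p).+1 >= 1 edges. *)
Definition two_even_cycles_joined_by_path (G : sgraph) : Prop :=
  exists (x y : G) (c d p : seq G),
    [/\ even_cycle_length c, even_cycle_length d,
        uniq ((x :: c) ++ (y :: d) ++ p)
      & union_of_walks [:: x :: rcons c x; y :: rcons d y; x :: rcons p y]].

Definition two_even_cycles_sharing_vertex (G : sgraph) : Prop :=
  exists (x : G) (c d : seq G),
    [/\ even_cycle_length c, even_cycle_length d,
        uniq (x :: c ++ d)
      & union_of_walks [:: x :: rcons c x; x :: rcons d x]].

(* ps lists the sequences of inner vertices of the paths joining the end
   vertices u and v.  [uniq ps] only matters for paths with a single edge: it
   prevents the edge uv from being counted twice. *)
Definition theta (ls : seq nat) (G : sgraph) : Prop :=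
  exists (u v : G) (ps : seq (seq G)),
    [/\ [seq (size p).+1 | p <- ps] = ls,
        uniq ps,
        uniq (u :: v :: flatten ps)
      & union_of_walks [seq u :: rcons p v | p <- ps]].

(* Main.v *)
(* Both directions reduce to arcs: an arc with inner lists [l1 ... ln] between
   vertices coloured [S] and [T] is passable if its inner vertices can be
   coloured.  When all lists have [2m] colours and [m] colours are chosen, the
   pairs [(S, T)] blocked by an arc are controlled by three sets of colours (see
   [arc_profile]), whatever the length of the arc.  An even cycle through a vertex
   therefore blocks at most two of its six colour sets, and forbidding two colour
   sets at one end of a path forbids at most two at the other; this settles (a)
   and (b).  For theta graphs only the traces of the three sets on the union of
   the lists of the two end vertices matter, which leaves a finite check.

   Conversely, a run of [j] inner vertices that copy the list of an end vertex
   just transmits its colour set, complemented when [j] is odd, so that one bad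
   list assignment for a small theta graph yields one for all longer ones.

   A critical graph has minimum degree at least two, and it is bipartite if it is
   (4:2)-choosable, so it contains an even cycle.  An even cycle and
   Theta_{2,2,2p} are 2-choosable, hence they are never the whole graph and an ear
   or a cycle hanging on a path can be attached to them; each way of doing so
   exhibits a listed graph, which is then all of the graph by criticality, a theta
   graph that is not (4:2)-choosable, or, starting from a cycle, Theta_{2,2,2p}. *)
Require Import Defs.
From mathcomp Require Import all_boot zify.

Set Implicit Arguments.
Unset Strict Implicit.
Unset Printing Implicit Defensive.

(** * Profiles of arcs *)

Lemma all2_rcons (A B : Type) (r : A -> B -> bool) s t x y :
  all2 r (rcons s x) (rcons t y) = all2 r s t && r x y.
Proof.
elim: s t => [|a s IHs] [|b t] //=; last by rewrite IHs andbA.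
- by rewrite andbT.
- by case: t => [|? ?]; rewrite andbF.
- by case: s {IHs} => [|? ?]; rewrite andbF.
Qed.

Lemma all2_size (A B : Type) (r : A -> B -> bool) s t :
  all2 r s t -> size s = size t.
Proof. by elim: s t => [|a s IHs] [|b t] //= /andP[_ /IHs ->]. Qed.

Section Arcs.
Variable C : finType.
Implicit Types (A B F S T U X Z l c : {set C}) (ls cs : seq {set C}) (m : nat).

Definition fits m c l := (c \subset l) && (#|c| == m).

Definition disj : rel {set C} := fun c d => [disjoint c & d].

Definition passable m S ls T :=
  exists2 cs, all2 (fits m) cs ls & path disj S (rcons cs T).

(** Turns an inequality between cardinals into one that can be checked colour by colour. *)
Lemma card_sum_mem X : #|X| = \sum_(c : C) (c \in X).
Proof. by rewrite -sum1_card big_mkcond. Qed.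

Lemma subset_of_card X m : m <= #|X| -> exists2 U : {set C}, U \subset X & #|U| = m.
Proof.
move=> le_mX; exists [set x | x \in take m (enum X)].
  by apply/subsetP => x; rewrite inE => /mem_take; rewrite mem_enum.
rewrite cardsE; have /card_uniqP -> := take_uniq m (enum_uniq X).
by rewrite size_takel // -cardE.
Qed.

(** Colours outside [Z] are taken first, so only the shortage has to come from [Z]. *)
Lemma subset_of_card_avoiding X Z m : m <= #|X| ->
  exists U : {set C}, [/\ U \subset X, #|U| = m & #|U :&: Z| <= m - #|X :\: Z|].
Proof.
move=> le_mX; case: (leqP m #|X :\: Z|) => [le_mZ | lt_Zm].
  have [U UXZ cU] := subset_of_card le_mZ.
  have [UX dUZ] := subsetDP UXZ.
  by exists U; split=> //; rewrite (disjoint_setI0 dUZ) cards0.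
have cX := cardsID Z X.
have [|V VXZ cV] := @subset_of_card (X :&: Z) (m - #|X :\: Z|); first lia.
have /subsetIP[VX VZ] := VXZ.
have dV : [disjoint X :\: Z & V].
  by rewrite disjoint_sym disjoints_subset (subset_trans VZ) // setCD subsetUr.
exists ((X :\: Z) :|: V); split.
- by rewrite subUset subsetDl.
- by rewrite cardsU (disjoint_setI0 dV) cards0; lia.
- rewrite -cV; apply: subset_leq_card; apply/subsetP => x; rewrite !inE.
  by case: (x \in Z); rewrite /= ?andbT ?andbF.
Qed.

Lemma passable_rcons m S ls M U T :
  passable m S ls U -> fits m U M -> disj U T -> passable m S (rcons ls M) T.
Proof.
move=> [cs fcs pcs] fU dUT; exists (rcons cs U).
  by rewrite all2_rcons fcs.
by rewrite rcons_path pcs last_rcons.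
Qed.

(** A linear sufficient condition for passing the arc: the colours of [S] and [T] are charged
    through [A], [B], [F], and [s] is the budget. The bounds relating [s] to the sizes of these sets
    carry the induction on the arc and later bound [s] from below by traces alone. *)
Definition arc_profile m ls A B F s : Prop :=
  [/\ [disjoint A & F], [disjoint B & F],
      if odd (size ls) then m <= s /\ #|A| + #|B| + #|F| <= s + m
      else #|A| <= s /\ #|B| <= s
    & forall S T, #|S| = m -> #|T| = m ->
      #|S :&: A| + #|T :&: B|
        + #|F :&: (if odd (size ls) then S :|: T else S :&: T)| <= s ->
      passable m S ls T].

Lemma disjoint_mem A B : [disjoint A & B] -> forall c : C, ~~ ((c \in A) && (c \in B)).
Proof.
by move=> dAB c; apply/negP => /andP[cA cB]; have := disjointFr dAB cA; rewrite cB.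
Qed.

(* [A] and [B] collect the colours present on an odd number of lists from the
   first, resp. last, list on but not on the whole arc, [F] those present on the
   whole arc; [s] is the number of colours that may be lost. *)
Lemma arc_profile_exists m ls : all (fun l => #|l| == m.*2) ls ->
  exists A B F s, arc_profile m ls A B F s.
Proof.
elim/last_ind: ls => [_|ls M IHls].
  exists set0, set0, setT, 0; split; rewrite ?cards0 ?disjoint0 //.
  - by rewrite -setI_eq0 set0I.
  - by rewrite -setI_eq0 set0I.
  move=> S T _ _; rewrite setTI leqn0 => h; exists [::] => //=.
  by rewrite andbT /disj -setI_eq0 -cards_eq0; lia.
rewrite all_rcons => /andP[/eqP cM /IHls {IHls}[A [B [F [s [dAF dBF]]]]]].
have memAF := disjoint_mem dAF; have memBF := disjoint_mem dBF.
rewrite /arc_profile size_rcons oddS.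
case: (odd (size ls)) => /= -[bnd1 bnd2] pass.
(* A colour of [F] missing from [M] lies on an odd number of lists from the first one on, so it
   moves to [A]. The subtraction is exact because [m <= s] for odd length. *)
- exists (A :|: F :\: M), (M :\: (B :|: F)), (F :&: M),
    (s + #|M :\: (B :|: F)| - m); split.
  + rewrite -setI_eq0; apply/eqP/setP => c; rewrite !inE.
    by have := memAF c; do ![case: (c \in _)].
  + rewrite -setI_eq0; apply/eqP/setP => c; rewrite !inE.
    by do ![case: (c \in _)].
  + have e1 : #|A :|: F :\: M| <= #|A| + #|F :\: M|.
      by rewrite cardsU leq_subr.
    have e2 : #|M| <= #|B| + #|F :&: M| + #|M :\: (B :|: F)|.
      rewrite !card_sum_mem -!big_split /=; apply: leq_sum => c _; rewrite !inE.
      by do ![case: (c \in _)].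
    have e3 := cardsID M F.
    split; lia.
  + move=> S T cS cT cost.
    (* The shorter arc charges [U] for [B] and for the part of [F] not already charged to [S], so
       [U] avoids these as far as possible. *)
    have [|U [UX cU cUZ]] := @subset_of_card_avoiding (M :\: T) (B :|: F :\: S) m.
      have := cardsID T M; have := subset_leq_card (subsetIr M T); lia.
    have /subsetDP[UM dUT] := UX.
    apply: (@passable_rcons m S ls M U T) => //; last by rewrite /fits UM cU eqxx.
    apply: pass => //.
    have e1 : #|S :&: A| + #|U :&: B| + #|F :&: (S :|: U)|
        <= #|S :&: A| + #|S :&: F| + #|U :&: (B :|: F :\: S)|.
      rewrite !card_sum_mem -!big_split /=; apply: leq_sum => c _; rewrite !inE.
      by have := memBF c; do ![case: (c \in _)].
    have e2 : #|M :\: (B :|: F)| + #|(F :&: M) :&: S| <=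
       #|(M :\: T) :\: (B :|: F :\: S)| + #|T :&: (M :\: (B :|: F))|
       + #|(F :&: M) :&: (S :&: T)|.
      rewrite !card_sum_mem -!big_split /=; apply: leq_sum => c _; rewrite !inE.
      by have := memBF c; do ![case: (c \in _)].
    have e3 : #|S :&: A| + #|S :&: F| <=
        #|S :&: (A :|: F :\: M)| + #|(F :&: M) :&: S|.
      rewrite !card_sum_mem -!big_split /=; apply: leq_sum => c _; rewrite !inE.
      by have := memAF c; do ![case: (c \in _)].
    have e4 : #|S :&: A| + #|S :&: F| <= #|S|.
      rewrite !card_sum_mem -!big_split /=; apply: leq_sum => c _; rewrite !inE.
      by have := memAF c; do ![case: (c \in _)].
    lia.
- have e0 : #|M :\: B| = #|M :\: (B :|: F)| + #|F :&: M|.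
    rewrite !card_sum_mem -!big_split /=; apply: eq_bigr => c _; rewrite !inE.
    by have := memBF c; do ![case: (c \in _)].
  have e0' := cardsID B M; have e0'' := subset_leq_card (subsetIr M B).
  (* Since [#|B| <= s], the sum [s + #|M :\: B|] is at least [m.*2]: the subtraction is exact and
     leaves at least [m]. *)
  exists A, (M :\: (B :|: F)), (F :&: M), (s + #|M :\: B| - m); split.
  + rewrite -setI_eq0; apply/eqP/setP => c; rewrite !inE.
    by have := memAF c; do ![case: (c \in _)].
  + rewrite -setI_eq0; apply/eqP/setP => c; rewrite !inE.
    by do ![case: (c \in _)].
  + split; lia.
  + move=> S T cS cT cost.
    (* An arc of even length charges [F] only on [S :&: U], so here [U] avoids [B] and [F :&: S]. *)
    have [|U [UX cU cUZ]] := @subset_of_card_avoiding (M :\: T) (B :|: F :&: S) m.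
      have := cardsID T M; have := subset_leq_card (subsetIr M T); lia.
    have /subsetDP[UM dUT] := UX.
    apply: (@passable_rcons m S ls M U T) => //; last by rewrite /fits UM cU eqxx.
    apply: pass => //.
    have e1 : #|S :&: A| + #|U :&: B| + #|F :&: (S :&: U)|
        <= #|S :&: A| + #|U :&: (B :|: F :&: S)|.
      rewrite !card_sum_mem -!big_split /=; apply: leq_sum => c _; rewrite !inE.
      by have := memBF c; do ![case: (c \in _)].
    have e2 : #|M :\: (B :|: F)| + #|F :&: M| <=
       #|(M :\: T) :\: (B :|: F :&: S)| + #|T :&: (M :\: (B :|: F))|
       + #|(F :&: M) :&: (S :|: T)|.
      rewrite !card_sum_mem -!big_split /=; apply: leq_sum => c _; rewrite !inE.
      by have := memBF c; do ![case: (c \in _)].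
    have e3 := subset_leq_card (subsetIr S A).
    lia.
Qed.

End Arcs.

(** * Finite check of the profiles *)

Fixpoint cprod (T : Type) (oss : seq (seq T)) : seq (seq T) :=
  if oss is os :: oss' then [seq x :: r | x <- os, r <- cprod oss'] else [:: [::]].

Lemma mem_cprod_map (A : eqType) (T : eqType) (g : A -> T) (o : A -> seq T) e :
  (forall c, c \in e -> g c \in o c) -> map g e \in cprod (map o e).
Proof.
elim: e => [|c e IHe] //= goc; apply: allpairs_f.
  by apply: goc; rewrite mem_head.
by apply: IHe => d de; apply: goc; rewrite inE de orbT.
Qed.

Lemma size_cprod (T : eqType) (oss : seq (seq T)) x :
  x \in cprod oss -> size x = size oss.
Proof.
elim: oss x => [|os oss IH] x /=; first by rewrite inE => /eqP->.
by case/allpairsP => -[a r] [_ /IH <- ->].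
Qed.

Lemma all_mem_cprod (T : eqType) (oss : seq (seq T)) x :
  x \in cprod oss -> all (fun z => z.1 \in z.2) (zip x oss).
Proof.
elim: oss x => [|os oss IH] x /=; first by rewrite inE => /eqP->.
by case/allpairsP => -[a r] [/= aos /IH aoss ->] /=; rewrite aos.
Qed.

(* Two lists [Lu] and [Lv] with [k := #|Lu :\: Lv|] are encoded by the sequence
   of the pairs [(c \in Lu, c \in Lv)] over the colours [c] of their union. *)
Definition list_pattern m k : seq (bool * bool) :=
  nseq k (true, false) ++ nseq (m.*2 - k) (true, true) ++ nseq k (false, true).

Definition bools := [:: false; true].

Definition pair_options (p : bool * bool) : seq (bool * bool) :=
  [seq q <- [seq (s, t) | s <- bools, t <- bools] | (q.1 ==> p.1) && (q.2 ==> p.2)].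

Definition colour_pairs m k : seq (seq (bool * bool)) :=
  [seq st <- cprod (map pair_options (list_pattern m k)) |
     (count fst st == m) && (count snd st == m)].

Definition profile_options (p : bool * bool) : seq (bool * bool * bool) :=
  [seq q <- [seq (ab, f) | ab <- [seq (a, b) | a <- bools, b <- bools], f <- bools] |
   [&& q.1.1 ==> p.1, q.1.2 ==> p.2, ~~ (q.1.1 && q.2) & ~~ (q.1.2 && q.2)]].

Definition profiles m k := cprod (map profile_options (list_pattern m k)).

(** An arc whose only inner vertex has the list [l] is governed by [A = B = set0] and [F = l]. *)
Definition single_profiles m k : seq (seq (bool * bool * bool)) :=
  [seq x <- cprod (map (fun=> [seq (false, false, f) | f <- bools]) (list_pattern m k)) |
     count snd x <= m.*2].

Definition loss (o : bool) (x : seq (bool * bool * bool)) (st : seq (bool * bool)) :=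
  sumn [seq (z.2.1 && z.1.1.1) + (z.2.2 && z.1.1.2)
            + ((if o then z.2.1 || z.2.2 else z.2.1 && z.2.2) && z.1.2) | z <- zip x st].

(** The least budget that the bounds of [arc_profile] allow for sets of these sizes. Passing from
    sets to their traces can only lower it, which is the safe direction. *)
Definition capacity (o : bool) m (x : seq (bool * bool * bool)) :=
  let a := count (fun q => q.1.1) x in
  let b := count (fun q => q.1.2) x in
  if o then maxn m (a + b + count snd x - m) else maxn a b.

Definition blocks o m x st := capacity o m x < loss o x st.

(* The boolean connectives evaluate both arguments under [vm_compute]; the
   functions below branch with [if] instead. *)
Fixpoint eq_bits (s t : seq bool) : bool :=
  match s, t with
  | [::], [::] => true
  | a :: s', b :: t' =>
    if a then if b then eq_bits s' t' else false
    else if b then false else eq_bits s' t'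
  | _, _ => false
  end.

Fixpoint mem_bits (s : seq bool) (ts : seq (seq bool)) : bool :=
  if ts is t :: ts' then if eq_bits s t then true else mem_bits s ts' else false.

Fixpoint add_bits (ss acc : seq (seq bool)) : seq (seq bool) :=
  if ss is s :: ss' then add_bits ss' (if mem_bits s acc then acc else s :: acc)
  else acc.

Lemma mem_bitsP s ts : mem_bits s ts -> s \in ts.
Proof.
have eqP' : forall s t, eq_bits s t -> s = t.
  elim=> [|a s' IHs] [|b t'] //=.
  by case: a; case: b => // /IHs ->.
elim: ts => [|t ts IHts] //=; rewrite inE.
by case: ifP => [/eqP' -> _ | _ /IHts ->]; rewrite ?eqxx ?orbT.
Qed.

Lemma mem_add_bits s ss acc : (s \in ss) || (s \in acc) -> s \in add_bits ss acc.
Proof.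
elim: ss acc => [|t ss IHss] acc //=; rewrite inE -orbA => mem_s; apply: IHss.
case: ifP => [/mem_bitsP tacc | _]; last by rewrite inE orbCA.
by case/orP: mem_s => [/eqP-> | //]; rewrite tacc orbT.
Qed.

Definition block_mask o m sts x :=
  let cap := capacity o m x in [seq cap < loss o x st | st <- sts].

(** Many profiles block the same pairs; removing duplicates keeps the covering search small. *)
Definition masks o m k :=
  let sts := colour_pairs m k in add_bits (map (block_mask o m sts) (profiles m k)) [::].

Definition single_masks m k :=
  let sts := colour_pairs m k in
  add_bits (map (block_mask true m sts) (single_profiles m k)) [::].

Definition blocked (ms : seq bool) i := nth false ms i.

(** Among masks that together block all of [js], one blocks its head, so the search branches only on
    the masks that do. *)
Fixpoint coverable (K : seq (seq bool)) n (js : seq nat) : bool :=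
  if js is j :: _ then
    if n is n'.+1 then
      has (fun ms => if blocked ms j then coverable K n' [seq i <- js | ~~ blocked ms i] else false) K
    else false
  else true.

Lemma not_coverableP K n js (mss : seq (seq bool)) :
  ~~ coverable K n js -> size mss = n -> {subset mss <= K} ->
  exists2 i, i \in js & all (fun ms => ~~ blocked ms i) mss.
Proof.
elim: n js mss => [|n IHn] [|j js] //= mss.
  by move=> _ /eqP; rewrite size_eq0 => /eqP-> _; exists j; rewrite ?mem_head.
move=> /hasPn ncov size_mss mssK.
case: (boolP (all (fun ms => ~~ blocked ms j) mss)) => [free|].
  by exists j; rewrite ?mem_head.
case/allPn => ms msmss; rewrite negbK => msj.
have := ncov ms (mssK _ msmss); rewrite msj => /IHn /=.
case/(_ (rem ms mss)).
- by rewrite size_rem // size_mss.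
- by move=> ms' /mem_rem /mssK.
move=> i; rewrite mem_filter => /andP[msi ijs] free.
exists i; first by rewrite inE ijs orbT.
by rewrite (perm_all _ (perm_to_rem msmss)) /= msi.
Qed.

Definition indices m k := iota 0 (size (colour_pairs m k)).

(** The mask of the arc with one inner vertex is fixed first; the two other arcs would have to block
    all the pairs it leaves free. *)
Definition theta_even_check m k :=
  let K := masks true m k in let js := indices m k in
  all (fun ms => ~~ coverable K 2 [seq i <- js | ~~ blocked ms i]) (single_masks m k).

Lemma theta_even_checked : all (theta_even_check 2) (iota 0 5).
Proof. by vm_cast_no_check (erefl true). Qed.

(** A single edge passes exactly the disjoint pairs, so these are the pairs that the two other arcs
    would have to block. *)
Definition theta_odd_check m k :=
  let sts := colour_pairs m k in
  ~~ coverable (masks false m k) 2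
    [seq i <- indices m k | ~~ has (fun q => q.1 && q.2) (nth [::] sts i)].

Lemma theta_odd_checked : all (theta_odd_check 2) (iota 0 5).
Proof. by vm_cast_no_check (erefl true). Qed.

Definition theta_2222_check m k := ~~ coverable (single_masks m k) 4 (indices m k).

Lemma theta_2222_checked : all (theta_2222_check 2) (iota 0 5).
Proof. by vm_cast_no_check (erefl true). Qed.

Definition theta_22_check m k :=
  let K := single_masks m k in let js := indices m k in
  all (fun ms => ~~ coverable K 2 [seq i <- js | ~~ blocked ms i]) (masks true m k).

Lemma theta_22_checked : all (theta_22_check 1) (iota 0 3).
Proof. by vm_cast_no_check (erefl true). Qed.

Definition closed_pair (st : seq (bool * bool)) := all (fun q => q.1 == q.2) st.

(** A cycle through a vertex is an arc whose two ends coincide: the two end lists are equal, hence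
    [k = 0], and only pairs [(S, S)] matter. *)
Definition cycle_check m :=
  let sts := [seq st <- colour_pairs m 0 | closed_pair st] in
  all (fun x => count (blocks true m x) sts <= m) (profiles m 0).

Lemma cycle_checked : cycle_check 1 && cycle_check 2.
Proof. by vm_cast_no_check (erefl true). Qed.

Lemma cycle_checkP m x : (m == 1) || (m == 2) -> x \in profiles m 0 ->
  count (blocks true m x) [seq st <- colour_pairs m 0 | closed_pair st] <= m.
Proof.
have /andP[chk1 chk2] := cycle_checked.
by case/orP => /eqP-> xP; [have := allP chk1 x xP | have := allP chk2 x xP].
Qed.

(** * Encoding of lists and profiles *)

Lemma map_constant (A B : eqType) (g : A -> B) s v :
  (forall x, x \in s -> g x = v) -> map g s = nseq (size s) v.
Proof.
elim: s => [|x s IHs] //= gv; rewrite gv ?mem_head // IHs // => y ys.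
by rewrite gv // inE ys orbT.
Qed.

Section Encoding.
Variables (C : finType) (m : nat) (Lu Lv : {set C}).
Hypotheses (cLu : #|Lu| = m.*2) (cLv : #|Lv| = m.*2).
Implicit Types (S T A B F X : {set C}).

Let k := #|Lu :\: Lv|.
(** The three blocks come in the order of [list_pattern]. *)
Let e := enum (Lu :\: Lv) ++ enum (Lu :&: Lv) ++ enum (Lv :\: Lu).

Lemma overlap_le : k <= m.*2.
Proof. by rewrite -cLu; apply/subset_leq_card/subsetDl. Qed.

Lemma mem_palette c : (c \in e) = (c \in Lu) || (c \in Lv).
Proof. by rewrite !mem_cat !mem_enum !inE; case: (c \in Lu); case: (c \in Lv). Qed.

Lemma palette_uniq : uniq e.
Proof.
rewrite !cat_uniq !enum_uniq /= andbT; apply/andP; split; apply/hasPn => c.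
  by rewrite mem_cat !mem_enum !inE; case: (c \in Lu); case: (c \in Lv).
by rewrite !mem_enum !inE; case: (c \in Lu); case: (c \in Lv).
Qed.

Lemma palette_pattern : [seq (c \in Lu, c \in Lv) | c <- e] = list_pattern m k.
Proof.
have e1 := cardsID Lv Lu; have e2 := cardsID Lu Lv; rewrite setIC in e2.
rewrite !map_cat /list_pattern; congr (_ ++ (_ ++ _)).
- rewrite (@map_constant _ _ _ _ (true, false)) -?cardE // => c.
  by rewrite mem_enum inE => /andP[/negbTE-> ->].
- rewrite (@map_constant _ _ _ _ (true, true)) -?cardE; first by congr nseq; lia.
  by move=> c; rewrite mem_enum inE => /andP[-> ->].
- rewrite (@map_constant _ _ _ _ (false, true)) -?cardE; first by congr nseq; lia.
  by move=> c; rewrite mem_enum inE => /andP[/negbTE-> ->].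
Qed.

Lemma count_palette (b : pred C) X :
  (forall c, c \in X -> c \in e) -> (forall c, c \in e -> b c = (c \in X)) ->
  count b e = #|X|.
Proof.
move=> Xe bX; rewrite -size_filter.
have /card_uniqP <- : uniq (filter b e) by rewrite filter_uniq ?palette_uniq.
apply: eq_card => c; rewrite mem_filter.
case ce: (c \in e); first by rewrite andbT bX.
by rewrite andbF; apply/esym/negbTE/negP => /Xe; rewrite ce.
Qed.

Lemma count_palette_le (b : pred C) X :
  (forall c, b c -> c \in X) -> count b e <= #|X|.
Proof.
move=> bX; rewrite -size_filter.
have /card_uniqP <- : uniq (filter b e) by rewrite filter_uniq ?palette_uniq.
by apply: subset_leq_card; apply/subsetP => c; rewrite mem_filter => /andP[/bX].
Qed.

Definition encode S T := [seq (c \in S, c \in T) | c <- e].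

Definition decode (bs : seq bool) : {set C} := [set c | nth false bs (index c e)].

Lemma map_decode bs : size bs = size e -> [seq c \in decode bs | c <- e] = bs.
Proof.
move=> size_bs; apply: (@eq_from_nth _ false); rewrite size_map // => i lt_ie.
have c0 : C by case: e lt_ie => [|c0 e'].
by rewrite (nth_map c0) // inE index_uniq // palette_uniq.
Qed.

Lemma encode_decode st : size st = size e ->
  encode (decode (unzip1 st)) (decode (unzip2 st)) = st.
Proof.
move=> size_st; rewrite -[RHS]zip_unzip.
rewrite -[in RHS](@map_decode (unzip1 st)) ?size_map //.
rewrite -[in RHS](@map_decode (unzip2 st)) ?size_map //.
by rewrite zip_map.
Qed.

Lemma colour_pair_decode st : st \in colour_pairs m k ->
  exists S T, [/\ fits m S Lu, fits m T Lv & encode S T = st].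
Proof.
rewrite mem_filter => /andP[/andP[/eqP c1 /eqP c2] st_prod].
have size_st : size st = size e.
  by rewrite (size_cprod st_prod) size_map -palette_pattern size_map.
set S := decode (unzip1 st); set T := decode (unzip2 st).
have stE : encode S T = st := encode_decode size_st.
have sub : forall c, ((c \in S) ==> (c \in Lu)) && ((c \in T) ==> (c \in Lv)).
  move=> c; case ce: (c \in e); last first.
    (* A colour off the palette has an index past the end of both bit sequences, where [nth] returns
       [false]. *)
    rewrite !inE (memNindex (negbT ce)) !nth_default ?size_map ?size_st //.
  have := all_mem_cprod st_prod.
  rewrite -stE -palette_pattern -map_comp zip_map all_map => /allP /(_ _ ce) /=.
  by rewrite mem_filter => /andP[].
have subS c : c \in S -> c \in Lu by move=> cS; have /andP[] := sub c; rewrite cS.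
have subT c : c \in T -> c \in Lv by move=> cT; have /andP[_] := sub c; rewrite cT.
exists S, T; split=> //; apply/andP; split.
- exact/subsetP.
- rewrite -c1 -stE count_map (@count_palette _ S) // => c /subS cL.
  by rewrite mem_palette cL.
- exact/subsetP.
- rewrite -c2 -stE count_map (@count_palette _ T) // => c /subT cL.
  by rewrite mem_palette cL orbT.
Qed.

Lemma encode_colour_pair S T : fits m S Lu -> fits m T Lv ->
  encode S T \in colour_pairs m k.
Proof.
move=> /andP[/subsetP SL /eqP cS] /andP[/subsetP TL /eqP cT].
rewrite mem_filter /encode !count_map (@count_palette _ S) ?(@count_palette _ T) //.
- rewrite cS cT eqxx /= -palette_pattern -map_comp; apply: mem_cprod_map => c _.
  rewrite mem_filter /=.
  have := SL c; have := TL c; case: (c \in S); case: (c \in T) => /= h1 h2;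
  by rewrite ?h1 ?h2 ?implybT ?inE.
- by move=> c /TL; rewrite mem_palette orbC => ->.
- by move=> c /SL; rewrite mem_palette => ->.
Qed.

(** As [S] and [T] lie inside [Lu] and [Lv], the loss only sees [A] on [Lu], [B] on [Lv], and [F] on
    the palette. *)
Definition encode_profile A B F :=
  [seq ((c \in A) && (c \in Lu), (c \in B) && (c \in Lv), c \in F) | c <- e].

Lemma mem_profiles A B F : [disjoint A & F] -> [disjoint B & F] ->
  encode_profile A B F \in profiles m k.
Proof.
move=> dAF dBF; rewrite /profiles -palette_pattern -map_comp.
apply: mem_cprod_map => c _; rewrite mem_filter /=.
have := disjoint_mem dAF c; have := disjoint_mem dBF c.
by case: (c \in A); case: (c \in B); case: (c \in F); case: (c \in Lu); case: (c \in Lv).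
Qed.

Lemma sumn_map3 (b1 b2 b3 : pred C) s :
  sumn [seq b1 c + b2 c + b3 c | c <- s] = count b1 s + count b2 s + count b3 s.
Proof. by elim: s => //= c s ->; lia. Qed.

Lemma loss_encode o A B F S T : S \subset Lu -> T \subset Lv ->
  loss o (encode_profile A B F) (encode S T) =
  #|S :&: A| + #|T :&: B| + #|F :&: (if o then S :|: T else S :&: T)|.
Proof.
move=> /subsetP SL /subsetP TL; rewrite /loss zip_map -map_comp /=.
rewrite (@eq_map _ _ _ (fun c => (c \in S :&: A) + (c \in T :&: B)
    + (c \in F :&: (if o then S :|: T else S :&: T)))); last first.
  move=> c /=; rewrite !inE; have := SL c; have := TL c.
  case: o; rewrite !inE; case: (c \in S); case: (c \in T) => /= h1 h2;
  by rewrite ?h1 ?h2 ?andbT ?andbF ?andbT.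
rewrite sumn_map3; congr (_ + _ + _); apply: count_palette => // c.
- by rewrite inE mem_palette => /andP[/SL ->].
- by rewrite inE mem_palette => /andP[/TL ->]; rewrite orbT.
- rewrite inE mem_palette => /andP[_]; case: o; rewrite !inE.
    by case/orP=> [/SL ->|/TL ->]; rewrite ?orbT.
  by case/andP => /SL ->.
Qed.

Lemma arc_blocks (ls : seq {set C}) : all (fun l : {set C} => #|l| == m.*2) ls ->
  exists2 x, x \in profiles m k & forall S T, fits m S Lu -> fits m T Lv ->
    ~~ blocks (odd (size ls)) m x (encode S T) -> passable m S ls T.
Proof.
move=> /arc_profile_exists[A [B [F [s [dAF dBF bnd pass]]]]].
exists (encode_profile A B F); first exact: mem_profiles.
move=> S T /andP[SL /eqP cS] /andP[TL /eqP cT].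
rewrite /blocks -leqNgt loss_encode // => le_loss; apply: pass => //.
apply: leq_trans le_loss _; rewrite /capacity.
have cA : count (fun q => q.1.1) (encode_profile A B F) <= #|A|.
  by rewrite count_map; apply: count_palette_le => c /andP[].
have cB : count (fun q => q.1.2) (encode_profile A B F) <= #|B|.
  by rewrite count_map; apply: count_palette_le => c /andP[].
have cF : count snd (encode_profile A B F) <= #|F|.
  by rewrite count_map; apply: count_palette_le.
case: (odd _) bnd => -[h1 h2]; lia.
Qed.

Lemma single_arc_blocks (l : {set C}) : #|l| = m.*2 ->
  exists2 x, x \in single_profiles m k & forall S T, fits m S Lu -> fits m T Lv ->
    ~~ blocks true m x (encode S T) -> passable m S [:: l] T.
Proof.
move=> cl; exists (encode_profile set0 set0 l).
  rewrite mem_filter count_map -cl count_palette_le //=.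
  rewrite -palette_pattern -map_comp; apply: mem_cprod_map => c _.
  by rewrite !inE; case: (c \in l).
move=> S T /andP[SL /eqP cS] /andP[TL /eqP cT].
rewrite /blocks -leqNgt loss_encode // => le_loss.
have {le_loss}le_loss : #|l :&: (S :|: T)| <= m.
  apply: leq_trans (leq_trans (leq_addl _ _) le_loss) _; rewrite /capacity.
  have cA : count (fun q => q.1.1) (encode_profile set0 set0 l) <= #|set0 : {set C}|.
    by rewrite count_map; apply: count_palette_le => c /andP[].
  have cB : count (fun q => q.1.2) (encode_profile set0 set0 l) <= #|set0 : {set C}|.
    by rewrite count_map; apply: count_palette_le => c /andP[].
  have cF : count snd (encode_profile set0 set0 l) <= #|l|.
    by rewrite count_map; apply: count_palette_le.
  rewrite !cards0 in cA cB; lia.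
have [U Ul cU] : exists2 U : {set C}, U \subset l :\: (S :|: T) & #|U| = m.
  by apply: subset_of_card; have := cardsID (S :|: T) l; lia.
have /subsetDP[Ull dU] := Ul; exists [:: U] => /=; first by rewrite /fits Ull cU eqxx.
move: dU; rewrite disjoint_sym disjoints_subset subUset -!disjoints_subset.
by rewrite /disj andbT => /andP[-> ]; rewrite disjoint_sym.
Qed.

Lemma mask_in o x : x \in profiles m k -> block_mask o m (colour_pairs m k) x \in masks o m k.
Proof. by move=> xp; apply: mem_add_bits; rewrite map_f. Qed.

Lemma single_mask_in x : x \in single_profiles m k ->
  block_mask true m (colour_pairs m k) x \in single_masks m k.
Proof. by move=> xp; apply: mem_add_bits; rewrite map_f. Qed.

Lemma unblocked_decode o x i st : i \in indices m k ->
  st = nth [::] (colour_pairs m k) i ->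
  ~~ blocked (block_mask o m (colour_pairs m k) x) i -> ~~ blocks o m x st.
Proof.
by rewrite mem_iota add0n => lti ->; rewrite /blocked (nth_map [::]).
Qed.

Lemma index_decode i : i \in indices m k ->
  exists S T, [/\ fits m S Lu, fits m T Lv
    & encode S T = nth [::] (colour_pairs m k) i].
Proof. by rewrite mem_iota add0n => lti; apply/colour_pair_decode/mem_nth. Qed.

End Encoding.

(** * Colourings of theta graphs and of pairs of cycles *)

Definition uniform (C : finType) a (ls : seq {set C}) := all (fun l : {set C} => #|l| == a) ls.

Section Positive.
Variable C : finType.
Implicit Types (Lu Lv Lx Ly l S T : {set C}) (ls lx ly : seq {set C}) (D : {set {set C}}).

Lemma theta_even_pass Lu Lv l ls1 ls2 :
  #|Lu| = 4 -> #|Lv| = 4 -> #|l| = 4 -> uniform 4 ls1 -> uniform 4 ls2 ->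
  odd (size ls1) -> odd (size ls2) ->
  exists S T, [/\ fits 2 S Lu, fits 2 T Lv, passable 2 S [:: l] T,
    passable 2 S ls1 T & passable 2 S ls2 T].
Proof.
move=> cLu cLv cl u1 u2 o1 o2.
have [x0 x0P pass0] := single_arc_blocks (m := 2) cLu cLv cl.
have [x1 x1P pass1] := arc_blocks (m := 2) cLu cLv u1.
have [x2 x2P pass2] := arc_blocks (m := 2) cLu cLv u2.
have lek : #|Lu :\: Lv| \in iota 0 5 by rewrite mem_iota; exact: (overlap_le (m := 2)).
have := allP theta_even_checked _ lek => /allP /(_ _ (single_mask_in x0P)) nc.
pose bm := block_mask true 2 (colour_pairs 2 #|Lu :\: Lv|).
have [|i] := not_coverableP nc (mss := [:: bm x1; bm x2]) erefl.
  by move=> ms; rewrite !inE => /orP[]/eqP->; apply: mask_in.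
rewrite mem_filter => /andP[f0 ik] /and3P[f1 f2 _].
have [S [T [fS fT ST]]] := index_decode (m := 2) cLu cLv ik.
exists S, T; split=> //.
- exact: pass0 fS fT (unblocked_decode ik ST f0).
- by apply: pass1 fS fT _; rewrite o1; apply: unblocked_decode ik ST f1.
- by apply: pass2 fS fT _; rewrite o2; apply: unblocked_decode ik ST f2.
Qed.

Lemma theta_odd_pass Lu Lv ls1 ls2 :
  #|Lu| = 4 -> #|Lv| = 4 -> uniform 4 ls1 -> uniform 4 ls2 ->
  ~~ odd (size ls1) -> ~~ odd (size ls2) ->
  exists S T, [/\ fits 2 S Lu, fits 2 T Lv, passable 2 S [::] T,
    passable 2 S ls1 T & passable 2 S ls2 T].
Proof.
move=> cLu cLv u1 u2 /negbTE o1 /negbTE o2.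
have [x1 x1P pass1] := arc_blocks (m := 2) cLu cLv u1.
have [x2 x2P pass2] := arc_blocks (m := 2) cLu cLv u2.
have lek : #|Lu :\: Lv| \in iota 0 5 by rewrite mem_iota; exact: (overlap_le (m := 2)).
have nc := allP theta_odd_checked _ lek.
pose bm := block_mask false 2 (colour_pairs 2 #|Lu :\: Lv|).
have [|i] := not_coverableP nc (mss := [:: bm x1; bm x2]) erefl.
  by move=> ms; rewrite !inE => /orP[]/eqP->; apply: mask_in.
rewrite mem_filter => /andP[/hasPn f0 ik] /and3P[f1 f2 _].
have [S [T [fS fT ST]]] := index_decode (m := 2) cLu cLv ik.
exists S, T; split=> //.
- exists [::] => //=; rewrite andbT /disj -setI_eq0; apply/eqP/setP => c.
  rewrite !inE; apply/negP => cST.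
  have /f0 : (c \in S, c \in T) \in nth [::] (colour_pairs 2 #|Lu :\: Lv|) i.
    rewrite -ST; apply: (map_f (fun c => (c \in S, c \in T))).
    rewrite mem_palette; case/andP: cST => cS _.
    by case/andP: fS => /subsetP /(_ _ cS) ->.
  by rewrite /= cST.
- by apply: pass1 fS fT _; rewrite o1; apply: unblocked_decode ik ST f1.
- by apply: pass2 fS fT _; rewrite o2; apply: unblocked_decode ik ST f2.
Qed.

Lemma theta_2222_pass Lu Lv (l : 'I_4 -> {set C}) :
  #|Lu| = 4 -> #|Lv| = 4 -> (forall i, #|l i| = 4) ->
  exists S T, [/\ fits 2 S Lu, fits 2 T Lv & forall i, passable 2 S [:: l i] T].
Proof.
move=> cLu cLv cl.
have /fin_all_exists2[x xP pass] := fun i => single_arc_blocks (m := 2) cLu cLv (cl i).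
have lek : #|Lu :\: Lv| \in iota 0 5 by rewrite mem_iota; exact: (overlap_le (m := 2)).
have nc := allP theta_2222_checked _ lek.
pose bm := block_mask true 2 (colour_pairs 2 #|Lu :\: Lv|).
have [||i ik /allP free] := not_coverableP nc (mss := [seq bm (x i) | i <- enum 'I_4]).
- by rewrite size_map size_enum_ord.
- by move=> ms /mapP[i _ ->]; apply: single_mask_in.
have [S [T [fS fT ST]]] := index_decode (m := 2) cLu cLv ik.
exists S, T; split=> // j; apply: pass fS fT (unblocked_decode ik ST _).
by apply: free; apply: map_f; rewrite mem_enum.
Qed.

Lemma theta_22_pass Lu Lv l1 l2 ls :
  #|Lu| = 2 -> #|Lv| = 2 -> #|l1| = 2 -> #|l2| = 2 -> uniform 2 ls -> odd (size ls) ->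
  exists S T, [/\ fits 1 S Lu, fits 1 T Lv, passable 1 S [:: l1] T,
    passable 1 S [:: l2] T & passable 1 S ls T].
Proof.
move=> cLu cLv cl1 cl2 u0 o0.
have [x0 x0P pass0] := arc_blocks (m := 1) cLu cLv u0.
have [x1 x1P pass1] := single_arc_blocks (m := 1) cLu cLv cl1.
have [x2 x2P pass2] := single_arc_blocks (m := 1) cLu cLv cl2.
have lek : #|Lu :\: Lv| \in iota 0 3 by rewrite mem_iota; exact: (overlap_le (m := 1)).
have := allP theta_22_checked _ lek => /allP /(_ _ (mask_in _ x0P)) nc.
pose bm := block_mask true 1 (colour_pairs 1 #|Lu :\: Lv|).
have [|i] := not_coverableP nc (mss := [:: bm x1; bm x2]) erefl.
  by move=> ms; rewrite !inE => /orP[]/eqP->; apply: single_mask_in.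
rewrite mem_filter => /andP[f0 ik] /and3P[f1 f2 _].
have [S [T [fS fT ST]]] := index_decode (m := 1) cLu cLv ik.
exists S, T; split=> //.
- exact: pass1 fS fT (unblocked_decode ik ST f1).
- exact: pass2 fS fT (unblocked_decode ik ST f2).
- by apply: pass0 fS fT _; rewrite o0; apply: unblocked_decode ik ST f0.
Qed.

Lemma cycle_pass (m : nat) Lu ls : (m == 1) || (m == 2) ->
  #|Lu| = m.*2 -> uniform m.*2 ls -> odd (size ls) ->
  exists2 D : {set {set C}}, #|D| <= m & forall S, fits m S Lu -> S \notin D -> passable m S ls S.
Proof.
move=> m12 cLu u1 o1.
have [x xP pass] := arc_blocks cLu cLu u1; rewrite o1 in pass.
have k0 : #|Lu :\: Lu| = 0 by rewrite setDv cards0.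
rewrite k0 in xP; have := cycle_checkP m12 xP.
set sts := [seq st <- _ | closed_pair st] => cnt.
(* The blocked closed pairs [(S, S)], read back as colour sets. *)
exists [set S in [seq decode Lu Lu (unzip1 st) | st <- sts & blocks true m x st]].
  rewrite cardsE (leq_trans (card_size _)) // size_map size_filter //.
move=> S fS; rewrite inE => notD; apply: pass => //; apply: contra notD => bl.
apply/mapP; exists (encode Lu Lu S S).
  have := encode_colour_pair cLu cLu fS fS; rewrite k0 => mem_st.
  rewrite mem_filter bl mem_filter mem_st andbT /=.
  by rewrite /closed_pair all_map; apply/allP => c _ /=.
apply/setP => c; rewrite inE /unzip1 -map_comp /=.
case ce: (c \in enum (Lu :\: Lu) ++ enum (Lu :&: Lu) ++ enum (Lu :\: Lu)).
  by rewrite (nth_map c) ?index_mem // nth_index.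
rewrite nth_default; last by rewrite size_map memNindex ?ce.
apply/negbTE/negP => cS; move: ce; rewrite mem_palette.
by case/andP: fS => /subsetP /(_ _ cS) ->.
Qed.

Lemma card_fits m l : #|[set S : {set C} | fits m S l]| = 'C(#|l|, m).
Proof. by rewrite -cards_draws; apply: eq_card => S; rewrite !inE. Qed.

Lemma fits_avoiding m l D : #|D| < 'C(#|l|, m) -> exists2 S : {set C}, fits m S l & S \notin D.
Proof.
rewrite -card_fits => ltD.
have /subsetPn[S] : ~~ ([set S : {set C} | fits m S l] \subset D).
  by apply/negP => /subset_leq_card; rewrite leqNgt ltD.
by rewrite inE; exists S.
Qed.

(** If [T] lies inside [Lu], the only choice left is [Lu :\: T], so it suffices to forbid the
    complements of the members of [D]. Otherwise at least three colours of [Lu] survive, which gives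
    three candidates against at most two in [D]. *)
Lemma forbidden_transfer_edge Lu Lv D : #|Lu| = 4 -> #|D| <= 2 ->
  exists2 D' : {set {set C}}, #|D'| <= 2 & forall T, fits 2 T Lv -> T \notin D' ->
    exists S, [/\ fits 2 S Lu, S \notin D & disj S T].
Proof.
move=> cLu cD; exists [set Lu :\: S | S in D].
  exact: leq_trans (leq_imset_card _ _) cD.
move=> T /andP[_ /eqP cT] TD.
have eL := cardsID T Lu; rewrite cLu in eL.
have le2 : #|Lu :&: T| <= 2 by rewrite -cT; apply/subset_leq_card/subsetIr.
case: (boolP (T \subset Lu)) => [TL|TnL].
  exists (Lu :\: T); split.
  - rewrite /fits subsetDl /=; move: eL; rewrite (setIidPr TL) cT; lia.
  - apply: contra TD => TD; apply/imsetP; exists (Lu :\: T) => //.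
    by rewrite setDDr setDv set0U (setIidPr TL).
  - by rewrite /disj -setI_eq0 setIC setIDA setIC setDIl setDv setI0.
have lt1 : #|Lu :&: T| <= 1.
  rewrite -ltnS -cT; apply: proper_card; rewrite properEneq subsetIr andbT.
  by apply: contra TnL => /eqP <-; apply: subsetIl.
have [|S /andP[SLT cS] SD] := @fits_avoiding 2 (Lu :\: T) D.
  apply: leq_ltn_trans cD _; apply: (@leq_trans 'C(3, 2)) => //.
  by apply: leq_bin2l; lia.
have /subsetDP[SL dST] := SLT; exists S; split=> //; exact/andP.
Qed.

Lemma forbidden_transfer Lu Lv ls D : #|Lu| = 4 -> uniform 4 ls -> #|D| <= 2 ->
  exists2 D' : {set {set C}}, #|D'| <= 2 & forall T, fits 2 T Lv -> T \notin D' ->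
    exists S, [/\ fits 2 S Lu, S \notin D & passable 2 S ls T].
Proof.
move=> cLu; elim/last_ind: ls Lv => [|ls M IHls] Lv.
  move=> _ cD; have [D' cD' D'P] := forbidden_transfer_edge Lv cLu cD.
  exists D' => // T fT TD'; have [S [fS SD dST]] := D'P T fT TD'.
  by exists S; split=> //; exists [::] => //=; rewrite dST.
rewrite /uniform all_rcons => /andP[/eqP cM uls] cD.
have [D1 cD1 D1P] := IHls M uls cD.
have [D' cD' D'P] := forbidden_transfer_edge Lv cM cD1.
exists D' => // T fT TD'; have [U [fU UD1 dUT]] := D'P T fT TD'.
have [S [fS SD pass]] := D1P U fU UD1.
by exists S; split=> //; apply: passable_rcons pass fU dUT.
Qed.

Lemma even_cycle_pass Lu ls : #|Lu| = 2 -> uniform 2 ls -> odd (size ls) ->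
  exists2 S : {set C}, fits 1 S Lu & passable 1 S ls S.
Proof.
move=> cLu u1 o1; have [D cD DP] := @cycle_pass 1 Lu ls isT cLu u1 o1.
have [|S fS SD] := @fits_avoiding 1 Lu D; first by rewrite cLu.
by exists S => //; apply: DP.
Qed.

Lemma two_cycles_joined_pass Lx Ly lx ly ls :
  #|Lx| = 4 -> #|Ly| = 4 -> uniform 4 lx -> uniform 4 ly -> uniform 4 ls ->
  odd (size lx) -> odd (size ly) ->
  exists S T, [/\ fits 2 S Lx, fits 2 T Ly, passable 2 S lx S, passable 2 T ly T
    & passable 2 S ls T].
Proof.
move=> cLx cLy ux uy us ox oy.
have [Dx cDx DxP] := @cycle_pass 2 Lx lx isT cLx ux ox.
have [Dy cDy DyP] := @cycle_pass 2 Ly ly isT cLy uy oy.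
have [D cD DP] := forbidden_transfer Ly cLx us cDx.
have [|T fT] := @fits_avoiding 2 Ly (D :|: Dy).
  rewrite cLy (@leq_ltn_trans 4) // cardsU; lia.
rewrite inE negb_or => /andP[TD TDy].
have [S [fS SD pass]] := DP T fT TD.
by exists S, T; split=> //; [apply: DxP | apply: DyP].
Qed.

Lemma two_cycles_sharing_pass Lx lx ly :
  #|Lx| = 4 -> uniform 4 lx -> uniform 4 ly -> odd (size lx) -> odd (size ly) ->
  exists S, [/\ fits 2 S Lx, passable 2 S lx S & passable 2 S ly S].
Proof.
move=> cLx ux uy ox oy.
have [Dx cDx DxP] := @cycle_pass 2 Lx lx isT cLx ux ox.
have [Dy cDy DyP] := @cycle_pass 2 Lx ly isT cLx uy oy.
have [|S fS] := @fits_avoiding 2 Lx (Dx :|: Dy).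
  rewrite cLx (@leq_ltn_trans 4) // cardsU; lia.
rewrite inE negb_or => /andP[SDx SDy].
by exists S; split=> //; [apply: DxP | apply: DyP].
Qed.

End Positive.

(** * Bad list assignments *)

(** The preceding vertex uses half of [L], so a vertex with list [L] must take exactly the other
    half. *)
Lemma passable_nseq (C : finType) m (L S T : {set C}) j ls :
  #|L| = m.*2 -> fits m S L -> passable m S (nseq j L ++ ls) T ->
  passable m (if odd j then L :\: S else S) ls T.
Proof.
move=> cL; elim: j S => [|j IHj] S //= fS [[|c cs] //= /andP[fc fcs] /andP[dSc pcs]].
have /andP[SL /eqP cS] := fS; have /andP[cL' /eqP cc] := fc.
have E : c = L :\: S.
  apply/eqP; rewrite eqEcard subsetD cL' cc disjoint_sym [[disjoint _ & _]]dSc /=.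
  by have := cardsID S L; rewrite (setIidPr SL); lia.
have := IHj c fc; rewrite if_neg E setDDr setDv set0U (setIidPr SL).
by case: (odd j) => /(_ _) h; apply: h; exists cs => //; rewrite -E.
Qed.

Lemma fits_setD (C : finType) m (L S : {set C}) :
  #|L| = m.*2 -> fits m S L -> fits m (L :\: S) L.
Proof.
move=> cL /andP[SL /eqP cS]; rewrite /fits subsetDl.
by have := cardsID S L; rewrite (setIidPr SL) /=; lia.
Qed.

(* Colours are the numbers below 6; colour sets are lists of numbers, so that
   the existence of a colouring of an arc can be decided by evaluation. *)
Definition colours (s : seq nat) : {set 'I_6} := [set i | val i \in s].

Definition valid (s : seq nat) := uniq s && all (fun n => n < 6) s.

Fixpoint subseqs (s : seq nat) : seq (seq nat) :=
  if s is x :: s' then [seq x :: t | t <- subseqs s'] ++ subseqs s' else [:: [::]].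

Definition picks m s := [seq t <- subseqs s | size t == m].

Definition disjointb (s t : seq nat) := ~~ has [in s] t.

Fixpoint passableb m s lss t : bool :=
  if lss is l :: lss' then
    has (fun x => if disjointb s x then passableb m x lss' t else false) (picks m l)
  else disjointb s t.

Lemma val_colours s : valid s -> perm_eq [seq val i | i <- enum (colours s)] s.
Proof.
case/andP => us /allP lt6; apply: uniq_perm => //.
  by rewrite map_inj_uniq ?enum_uniq //; apply: val_inj.
move=> n; apply/mapP/idP => [[i] | ns]; first by rewrite mem_enum inE => h ->.
by exists (Ordinal (lt6 _ ns)); rewrite // mem_enum inE.
Qed.

Lemma card_colours s : valid s -> #|colours s| = size s.
Proof. by move=> /val_colours /perm_size <-; rewrite size_map -cardE. Qed.

Lemma filter_subseqs (a : pred nat) s : filter a s \in subseqs s.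
Proof.
elim: s => [|n s IHs] //=; rewrite mem_cat.
by case: (a n); rewrite ?IHs ?orbT // map_f.
Qed.

Lemma fits_picks m (c : {set 'I_6}) s : valid s -> fits m c (colours s) ->
  exists t, [/\ t \in picks m s, valid t & c = colours t].
Proof.
move=> vs /andP[/subsetP cs /eqP cc].
set t := [seq n <- s | n \in [seq val i | i <- enum c]].
have ct : c = colours t.
  apply/setP => i; rewrite inE mem_filter mem_map ?mem_enum; last exact: val_inj.
  by case ic: (i \in c) => //=; have := cs i ic; rewrite inE.
have vt : valid t.
  case/andP: vs => us /allP lt6; rewrite /valid filter_uniq //=.
  by apply/allP => n; rewrite mem_filter => /andP[_ /lt6].
by exists t; split=> //; rewrite mem_filter filter_subseqs andbT -card_colours // -ct cc.
Qed.

Lemma disj_disjointb s t : valid s -> disj (colours s) (colours t) -> disjointb s t.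
Proof.
move=> /andP[_ /allP lt6] dst; apply/hasPn => n nt; apply/negP => ns.
have := disjoint_mem dst (Ordinal (lt6 n ns)); rewrite !inE /= ns.
by move: nt => ->.
Qed.

Lemma passable_passableb m s lss t : valid s -> all valid lss ->
  passable m (colours s) (map colours lss) (colours t) -> passableb m s lss t.
Proof.
elim: lss s => [|l lss IH] s vs /=.
  by move=> _ [[|//] _ /= /andP[/disj_disjointb]] -> .
move=> /andP[vl vlss] [[//|c cs] /= /andP[fc fcs] /andP[dsc pcs]].
have [x [xl vx cx]] := fits_picks vl fc; subst c.
apply/hasP; exists x => //; rewrite (disj_disjointb vs dsc).
by apply: IH => //; exists cs.
Qed.

Definition theta_blocked m lu lv (bases : seq (seq (seq nat))) :=
  [&& valid lu, valid lv, all (all valid) bases &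
  all (fun s => all (fun t => ~~ all (fun ls => passableb m s ls t) bases) (picks m lv))
    (picks m lu)].

Lemma theta_blockedP m lu lv bases S T : theta_blocked m lu lv bases ->
  fits m S (colours lu) -> fits m T (colours lv) ->
  ~ (forall b, b \in bases -> passable m S (map colours b) T).
Proof.
case/and4P => vu vv /allP vb /allP chk fS fT pass.
have [s [su vs Es]] := fits_picks vu fS.
have [t [tv vt Et]] := fits_picks vv fT.
have /negP[] := allP (chk s su) t tv; apply/allP => b bb.
by apply: passable_passableb (vb _ bb) _ => //; rewrite -Es -Et; apply: pass.
Qed.

(* Prefixing every arc with the same parity of copies of the list of [u] only
   replaces the colour set of [u] by its complement. *)
Lemma theta_prefix_blocked m lu lv bases (o : bool) S T :
  size lu = m.*2 -> theta_blocked m lu lv bases ->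
  fits m S (colours lu) -> fits m T (colours lv) ->
  ~ (forall b, b \in bases -> exists2 j, odd j = o &
       passable m S (nseq j (colours lu) ++ map colours b) T).
Proof.
move=> slu blk fS fT pass.
have cL : #|colours lu| = m.*2 by case/andP: (blk) => vu _; rewrite card_colours.
apply: (theta_blockedP (S := if o then colours lu :\: S else S) blk _ fT).
  by case: (o) => //; apply: fits_setD.
move=> b /pass[j <-]; exact: passable_nseq.
Qed.

(* The list assignments below were found by exhaustive search. *)
Definition theta_long_bases := [:: [:: [:: 0; 1; 2; 4]; [:: 0; 1; 3; 4]];
  [:: [:: 0; 1; 3; 4]; [:: 0; 2; 3; 4]]; [:: [:: 0; 2; 3; 4]; [:: 0; 1; 2; 4]]].

Lemma theta_long_blocked :
  theta_blocked 2 [:: 0; 1; 2; 3] [:: 0; 1; 2; 3] theta_long_bases.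
Proof. by vm_compute. Qed.

Definition theta_2222t_bases := [:: [:: [:: 0; 2; 3; 4]]; [:: [:: 0; 2; 3; 5]];
  [:: [:: 1; 2; 4; 5]]; [:: [:: 0; 1; 2; 3]; [:: 0; 1; 2; 4]; [:: 1; 2; 3; 4]]].

Lemma theta_2222t_blocked :
  theta_blocked 2 [:: 0; 1; 2; 3] [:: 2; 3; 4; 5] theta_2222t_bases.
Proof. by vm_compute. Qed.

(** Theta_{1,3,3}: the edge forces distinct colours at the ends, and each of the two other arcs
    blocks one of the two remaining pairs. *)
Definition theta_short_bases :=
  [:: [::]; [:: [:: 0; 2]; [:: 1; 2]]; [:: [:: 1; 2]; [:: 0; 2]]].

Lemma theta_short_blocked : theta_blocked 1 [:: 0; 1] [:: 0; 1] theta_short_bases.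
Proof. by vm_compute. Qed.

(** The classical bad assignment of [K_{2,4}]: for each choice of a colour from [{0, 1}] and one
    from [{2, 3}], some middle vertex has exactly these two colours as its list. *)
Definition theta_2222_bases :=
  [:: [:: [:: 0; 2]]; [:: [:: 0; 3]]; [:: [:: 1; 2]]; [:: [:: 1; 3]]].

Lemma theta_2222_blocked : theta_blocked 1 [:: 0; 1] [:: 2; 3] theta_2222_bases.
Proof. by vm_compute. Qed.

(** * Colourings along walks *)

(** Comparing multiplicities covers reordering, reversing and dropping segments of a sequence at
    once, and leaves only linear arithmetic. *)
Lemma uniq_count_le (T : eqType) (s1 s2 : seq T) :
  (forall a : pred T, count a s2 <= count a s1) -> uniq s1 -> uniq s2.
Proof.
move=> le12 u1; apply: count_mem_uniq => x.
have : count_mem x s2 <= 1.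
  by apply: leq_trans (le12 _) _; rewrite count_uniq_mem // leq_b1.
by rewrite -has_pred1 has_count; case: (count_mem x s2) => [|[|n]].
Qed.

(* [lia] splits on every [nat_of_bool], hence the generalizations. *)
Ltac uniq_from H := move: H; apply: uniq_count_le => ?;
  rewrite /=; repeat first [rewrite count_cat /= | rewrite count_rev /=];
  repeat match goal with |- context [?t] =>
    match t with nat_of_bool _ => idtac | count _ _ => idtac end; generalize t; intro
  end; clear; lia.

(** Choosability of the graph formed by the walks, stated on the ambient vertex type so that no
    subgraph has to be built. *)
Definition walk_choosable a b (T : finType) (ws : seq (seq T)) : Prop :=
  forall (C : finType) (L : T -> {set C}), (forall v, #|L v| = a) ->
  exists2 f : T -> {set C}, forall v, fits b (f v) (L v)
    & all (fun w => sorted (@disj C) (map f w)) ws.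

Lemma choosable_walk_choosable a b (G : sgraph) (ws : seq (seq G)) :
  choosable a b G -> all (sorted (@edge G)) ws -> walk_choosable a b ws.
Proof.
move=> chG wsG C L cL; have [f [fL fd]] := chG C L cL; exists f.
  by move=> v; have [fv cv] := fL v; rewrite /fits fv cv eqxx.
apply/allP => w /(allP wsG); rewrite sorted_map; apply: sub_sorted => x y exy.
by rewrite /= /disj -setI_eq0 fd.
Qed.

Lemma sorted_infix2 (T : eqType) (e : rel T) w x y :
  sorted e w -> infix [:: x; y] w -> e x y.
Proof.
move=> sw /infixP[s1 [s2 Ew]]; move: sw; rewrite Ew => /cat_sorted2[_].
by move=> /= /andP[].
Qed.

Lemma disj_sym (C : finType) : symmetric (@disj C).
Proof. by move=> c d; rewrite /disj disjoint_sym. Qed.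

Lemma walk_choosable_choosable a b (G : sgraph) (ws : seq (seq G)) :
  union_of_walks ws -> walk_choosable a b ws -> choosable a b G.
Proof.
move=> [_ wsG] wch C L cL; have [f fL /allP fd] := wch C L cL; exists f; split.
  by move=> v; have /andP[-> /eqP] := fL v.
move=> x y; rewrite wsG => /hasP[w /fd]; rewrite sorted_map => sw wxy.
apply/eqP; rewrite setI_eq0 -/(disj _ _).
case/orP: wxy => [/(sorted_infix2 sw) // | /(sorted_infix2 sw)].
by rewrite disj_sym.
Qed.

Lemma walk_edge_cons (T : eqType) (z : T) w : subrel (walk_edge w) (walk_edge (z :: w)).
Proof.
move=> x y /orP[] /infixP[s1 [s2 ->]]; apply/orP; [left | right];
  by apply/infixP; exists (z :: s1), s2.
Qed.

Lemma sorted_walk_edge (T : eqType) (w : seq T) : sorted (walk_edge w) w.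
Proof.
elim: w => [|x [|y s] IH] //; apply/andP; split.
  by apply/orP; left; apply/infixP; exists [::], s.
exact: sub_sorted (@walk_edge_cons T x (y :: s)) _ IH.
Qed.

Section WalkSubgraph.
Variables (G : sgraph) (ws : seq (seq G)).
Hypothesis wsG : all (sorted (@edge G)) ws.

Definition walks_edge : rel G := fun x y => has (fun w => walk_edge w x y) ws.

Lemma walks_edge_sym : symmetric walks_edge.
Proof. by move=> x y; apply: eq_has => w; rewrite /walk_edge orbC. Qed.

Lemma infix2_mem (T : eqType) (w : seq T) x y :
  infix [:: x; y] w -> (x \in w) && (y \in w).
Proof. by move/mem_infix => h; rewrite !h ?inE ?eqxx ?orbT. Qed.

Lemma walks_edgeP x y : walks_edge x y ->
  [&& x \in [set x | has (fun w => x \in w) ws],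
      y \in [set x | has (fun w => x \in w) ws] & edge x y].
Proof.
case/hasP => w wws wxy; rewrite !inE.
have sw := allP wsG w wws; rewrite -[edge x y]orbb {2}edge_sym.
case/orP: wxy => inf; have /andP[m1 m2] := infix2_mem inf.
  by rewrite (sorted_infix2 sw inf) /=; apply/andP; split; [|rewrite andbT];
     apply/hasP; exists w.
by rewrite (sorted_infix2 sw inf) /= orbT; apply/andP; split; [|rewrite andbT];
     apply/hasP; exists w.
Qed.

Definition walk_subgraph : subgraph G := Subgraph walks_edge_sym walks_edgeP.

Lemma walk_subgraph_choosable a b : b <= a ->
  choosable a b (graph_of_subgraph walk_subgraph) -> walk_choosable a b ws.
Proof.
move=> le_ba ch C L cL.
have [f [fL fd]] := ch C (fun v => L (val v)) (fun v => cL _).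
(* Vertices outside the subgraph receive arbitrary sets [g v] from their lists. *)
have /fin_all_exists2[g gL cg] : forall v, exists2 U : {set C}, U \subset L v & #|U| = b.
  by move=> v; apply: subset_of_card; rewrite cL.
pose h v := if insub v is Some v' then f v' else g v.
exists h => [v|].
  rewrite /h; case: insubP => [v' _ <- | _]; first by have [? ?] := fL v'; exact/andP/(conj _ (introT eqP _)).
  by rewrite /fits gL cg eqxx.
apply/allP => w wws; rewrite sorted_map.
have vw x : x \in w -> x \in sub_verts walk_subgraph.
  by move=> xw; rewrite inE; apply/hasP; exists w.
have : sorted (walk_edge w) w.
  exact: sorted_walk_edge.
apply: sub_sorted => x y wxy.
have /andP[xw yw] : (x \in w) && (y \in w).
  by case/orP: wxy => /infix2_mem /andP[-> ->].
rewrite /= /h /disj (insubT (fun z => z \in sub_verts walk_subgraph) (vw _ xw)).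
rewrite (insubT (fun z => z \in sub_verts walk_subgraph) (vw _ yw)) -setI_eq0.
rewrite fd //; rewrite /= /graph_sub_edge /=.
by apply/hasP; exists w.
Qed.

(** Proper subgraphs of a critical graph are 2-choosable, so walks that are not 2-choosable must
    already form the whole graph. *)
Lemma critical_union_of_walks : three_choosable_critical G ->
  ~ walk_choosable 2 1 ws -> union_of_walks ws.
Proof.
move=> [_ crit] nch.
have nprop : ~ proper_subgraph walk_subgraph.
  by move=> /crit /(walk_subgraph_choosable (leqnSn 1)).
split=> [x | x y].
  apply/idPn => nx; case: nprop; left; apply/eqP => /setP /(_ x).
  by rewrite !inE (negbTE nx).
apply/idP/idP => [exy | wxy].
  by apply/idPn => nxy; case: nprop; right; exists x, y.
by have /and3P[] := walks_edgeP wxy.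
Qed.

End WalkSubgraph.

(** * Colouring graphs composed of arcs *)

Definition arc_walk (T : Type) (a : T * seq T * T) := a.1.1 :: rcons a.1.2 a.2.

Section ArcColouring.
Variables (T : finType) (a b : nat).
Implicit Types (arcs : seq (T * seq T * T)).

Lemma walk_choosable_passable arcs : walk_choosable a b (map (@arc_walk T) arcs) ->
  forall (C : finType) (L : T -> {set C}), (forall v, #|L v| = a) ->
  exists2 f : T -> {set C}, forall v, fits b (f v) (L v)
    & forall u p v, (u, p, v) \in arcs -> passable b (f u) (map L p) (f v).
Proof.
move=> wch C L cL; have [f fL /allP fd] := wch C L cL; exists f => // u p v uv.
have := fd _ (map_f (@arc_walk T) uv); rewrite /arc_walk /= map_rcons => pd.
exists (map f p) => //; elim: p {uv pd} => //= x p ->.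
by rewrite fL.
Qed.

(** Inner vertices of different arcs are distinct and never serve as ends, so once the ends are
    coloured the arcs can be filled in independently. *)
Lemma passable_walk_choosable arcs :
  uniq (flatten [seq t.1.2 | t <- arcs]) ->
  (forall u p v, (u, p, v) \in arcs ->
    (u \notin flatten [seq t.1.2 | t <- arcs]) && (v \notin flatten [seq t.1.2 | t <- arcs])) ->
  (forall (C : finType) (L : T -> {set C}), (forall v, #|L v| = a) ->
   exists2 g : T -> {set C}, forall v, fits b (g v) (L v)
    & forall u p v, (u, p, v) \in arcs -> passable b (g u) (map L p) (g v)) ->
  walk_choosable a b (map (@arc_walk T) arcs).
Proof.
move=> uniq_in ends pass C L cL; have [g gL {}pass] := pass C L cL.
(* The induction also keeps [f] equal to [g] off the inner vertices, so that the ends retain their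
   prescribed colours. *)
suff [f [fL fg fd]] : exists f : T -> {set C}, [/\ forall v, fits b (f v) (L v),
    forall v, v \notin flatten [seq t.1.2 | t <- arcs] -> f v = g v
    & all (fun w => sorted (@disj C) (map f w)) (map (@arc_walk T) arcs)] by exists f.
elim: arcs uniq_in ends pass => [|[[u p] v] arcs IH] /=; first by exists g.
rewrite cat_uniq => /and3P[up /hasPn disj_in uarcs] ends pass.
have [||f [fL fg fd]] := IH uarcs.
- move=> u' p' v' h; have := ends u' p' v'; rewrite inE h orbT => /(_ isT).
  by rewrite !mem_cat !negb_or => /andP[/andP[_ ->] /andP[_ ->]].
- by move=> u' p' v' h; apply: pass; rewrite inE h orbT.
have [cs fcs pcs] := pass u p v (mem_head _ _).
have szcs : size cs = size p by rewrite (all2_size fcs) size_map.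
have := ends u p v (mem_head _ _); rewrite !mem_cat !negb_or.
case/andP => /andP[nup nu] /andP[nvp nv].
pose h x := if x \in p then nth set0 cs (index x p) else f x.
have hp : map h p = cs.
  apply: (@eq_from_nth _ set0); rewrite size_map // => i ltip.
  have x0 : T by case: (p) ltip.
  by rewrite (nth_map x0) // /h mem_nth // index_uniq.
have hnp x : x \notin p -> h x = f x by rewrite /h => /negbTE->.
exists h; split.
- move=> x; rewrite /h; case: ifP => // xp.
  have ltix : index x p < size p by rewrite index_mem.
  move: fcs; rewrite all2E => /andP[_ /allP /(_ (nth set0 cs (index x p), L x))] /=.
  apply; rewrite -[L x](_ : nth set0 (map L p) (index x p) = L x); last first.
    by rewrite (nth_map x) // nth_index.
  rewrite -nth_zip ?size_map //; apply: mem_nth.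
  by rewrite size_zip size_map szcs minnn.
- by move=> x; rewrite mem_cat negb_or => /andP[xp xin]; rewrite hnp // fg.
- rewrite map_rcons hp !hnp // !fg // pcs /=.
  apply/allP => w wa; rewrite (_ : map h w = map f w); first exact: allP fd w wa.
  apply/eq_in_map => x xw; apply: hnp; apply/negP => xp.
  have /mapP[[[u' p'] v'] a' Ew] := wa.
  have := ends u' p' v'; rewrite inE a' orbT => /(_ isT).
  rewrite !mem_cat !negb_or => /andP[/andP[nu'p _] /andP[nv'p _]].
  move: xw; rewrite Ew /arc_walk /= inE mem_rcons inE => /or3P[/eqP E|/eqP E|xp'].
  + by rewrite -E xp in nu'p.
  + by rewrite -E xp in nv'p.
  + have /disj_in : x \in flatten [seq t.1.2 | t <- arcs].
      by apply/flattenP; exists p' => //; apply/mapP; exists (u', p', v').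
    by rewrite /= xp.
Qed.

(** Turns values prescribed along disjoint vertex sequences into one function, with [d] at all other
    vertices. *)
Lemma labelling_exists (X : eqType) (P : pred X) (d : X) (vss : seq (seq T)) (valss : seq (seq X)) :
  uniq (flatten vss) -> shape valss = shape vss -> P d -> all (all P) valss ->
  exists2 L : T -> X, map (map L) vss = valss & forall v, P (L v).
Proof.
move=> uv sh Pd Pv; exists (fun v => nth d (flatten valss) (index v (flatten vss))).
  apply: eq_from_flatten_shape; last first.
    rewrite sh /shape -map_comp; apply: eq_map => s /=; exact: size_map.
  have sz : size (flatten valss) = size (flatten vss) by rewrite !size_flatten sh.
  rewrite -map_flatten; apply: (@eq_from_nth _ d); rewrite size_map // => i lti.
  have x0 : T by case: (flatten vss) lti.
  by rewrite (nth_map x0) // index_uniq.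
move=> v; have Pf x : x \in flatten valss -> P x.
  by case/flattenP => s sv xs; apply: allP (allP Pv s sv) x xs.
case: (ltnP (index v (flatten vss)) (size (flatten valss))) => lt; first by apply/Pf/mem_nth.
by rewrite nth_default.
Qed.

Lemma default_colouring (C : finType) (L : T -> {set C}) : b <= a -> (forall v, #|L v| = a) ->
  exists g : T -> {set C}, forall v, fits b (g v) (L v).
Proof.
move=> le_ba cL.
have /fin_all_exists2[g gL cg] : forall v, exists2 U : {set C}, U \subset L v & #|U| = b.
  by move=> v; apply: subset_of_card; rewrite cL.
by exists g => v; rewrite /fits gL cg eqxx.
Qed.

End ArcColouring.

(** * The families of graphs *)

Section Families.
Variable T : finType.
Implicit Types (u v x y : T) (p c d : seq T) (ps cs : seq (seq T)).

Lemma theta_walk_choosable a b u v ps : b <= a -> uniq (u :: v :: flatten ps) ->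
  (forall (C : finType) (Lu Lv : {set C}) (lss : seq (seq {set C})),
    #|Lu| = a -> #|Lv| = a -> all (uniform a) lss -> shape lss = shape ps ->
    exists S U, [/\ fits b S Lu, fits b U Lv
      & forall ls, ls \in lss -> passable b S ls U]) ->
  walk_choosable a b [seq u :: rcons p v | p <- ps].
Proof.
move=> le_ba /=; rewrite inE negb_or => /andP[/andP[nuv nu] /andP[nv ups]] pass.
have -> : [seq u :: rcons p v | p <- ps] = map (@arc_walk T) [seq (u, p, v) | p <- ps].
  by rewrite -map_comp.
have inner : [seq t.1.2 | t <- [seq (u, p, v) | p <- ps]] = ps.
  by rewrite -map_comp map_id.
apply: passable_walk_choosable; rewrite ?inner //.
  by move=> u' p' v' /mapP[p _ [-> _ ->]]; rewrite nu.
move=> C L cL; have [g gL] := default_colouring le_ba cL.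
have [|||| S [U [fS fU STpass]]] := pass C (L u) (L v) (map (map L) ps) => //.
- by apply/allP => ls /mapP[p _ ->]; apply/allP => l /mapP[z _ ->]; rewrite cL.
- by rewrite /shape -map_comp; apply: eq_map => p /=; rewrite size_map.
exists [eta g with u |-> S, v |-> U] => [z | u' p' v' /mapP[p pps [-> -> ->]]] /=.
  by case: eqP => [->|_] //; case: eqP => [->|_].
by rewrite eqxx eq_sym (negbTE nuv) eqxx; apply/STpass/map_f.
Qed.

Lemma cycles_walk_choosable a b x cs : b <= a -> uniq (x :: flatten cs) ->
  (forall (C : finType) (Lx : {set C}) (lss : seq (seq {set C})),
    #|Lx| = a -> all (uniform a) lss -> shape lss = shape cs ->
    exists2 S, fits b S Lx & forall ls, ls \in lss -> passable b S ls S) ->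
  walk_choosable a b [seq x :: rcons c x | c <- cs].
Proof.
move=> le_ba /= /andP[nx ucs] pass.
have -> : [seq x :: rcons c x | c <- cs] = map (@arc_walk T) [seq (x, c, x) | c <- cs].
  by rewrite -map_comp.
have inner : [seq t.1.2 | t <- [seq (x, c, x) | c <- cs]] = cs.
  by rewrite -map_comp map_id.
apply: passable_walk_choosable; rewrite ?inner //.
  by move=> u' p' v' /mapP[p _ [-> _ ->]]; rewrite nx.
move=> C L cL; have [g gL] := default_colouring le_ba cL.
have [||| S fS Spass] := pass C (L x) (map (map L) cs) => //.
- by apply/allP => ls /mapP[p _ ->]; apply/allP => l /mapP[z _ ->]; rewrite cL.
- by rewrite /shape -map_comp; apply: eq_map => p /=; rewrite size_map.
exists [eta g with x |-> S] => [z | u' p' v' /mapP[p pps [-> -> ->]]] /=.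
  by case: eqP => [->|_].
by rewrite eqxx; apply/Spass/map_f.
Qed.

Lemma joined_cycles_walk_choosable x y c d p :
  even_cycle_length c -> even_cycle_length d -> uniq ((x :: c) ++ (y :: d) ++ p) ->
  walk_choosable 4 2 [:: x :: rcons c x; y :: rcons d y; x :: rcons p y].
Proof.
move=> /andP[_ evc] /andP[_ evd] uq.
apply: (@passable_walk_choosable T 4 2 [:: (x, c, x); (y, d, y); (x, p, y)]) => /=.
- by uniq_from uq.
- have [nx ny] : x \notin c ++ d ++ p ++ [::] /\ y \notin c ++ d ++ p ++ [::].
    have ux : uniq (x :: c ++ d ++ p ++ [::]) by uniq_from uq.
    have uy : uniq (y :: c ++ d ++ p ++ [::]) by uniq_from uq.
    by case/andP: ux => -> _; case/andP: uy.
  by move=> u' p' v'; rewrite !inE => /or3P[] /eqP[-> _ ->]; rewrite ?nx ?ny.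
move=> C L cL; have [g gL] := default_colouring (isT : 2 <= 4) cL.
have un q : uniform 4 (map L q) by apply/allP => l /mapP[z _ ->]; rewrite cL.
have [|| S [U [fS fU pc pd pp]]] :=
  two_cycles_joined_pass (cL x) (cL y) (un c) (un d) (un p).
- by rewrite size_map; move: evc; rewrite /= negbK.
- by rewrite size_map; move: evd; rewrite /= negbK.
have nxy : x != y.
  have uxy : uniq [:: x; y] by uniq_from uq.
  by move: uxy; rewrite /= inE => /andP[].
exists [eta g with x |-> S, y |-> U] => [z | u' p' v'] /=.
  by case: eqP => [->|_] //; case: eqP => [->|_].
by rewrite !inE => /or3P[] /eqP[-> -> ->]; rewrite ?eqxx ?(eq_sym y) ?(negbTE nxy).
Qed.

Lemma sharing_cycles_walk_choosable x c d :
  even_cycle_length c -> even_cycle_length d -> uniq (x :: c ++ d) ->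
  walk_choosable 4 2 [:: x :: rcons c x; x :: rcons d x].
Proof.
move=> /andP[_ /negPn oc] /andP[_ /negPn od] uq.
apply: (@cycles_walk_choosable 4 2 x [:: c; d]); rewrite //= ?cats0 //.
move=> C Lx [|lc [|ld [|? ?]]] //= cLx /and3P[uc ud _] [sc sd].
have [||S [fS pc pd]] := two_cycles_sharing_pass cLx uc ud; rewrite ?sc ?sd //.
by exists S => // ls; rewrite !inE => /orP[] /eqP->.
Qed.

Lemma even_cycle_walk_choosable x c : even_cycle_length c -> uniq (x :: c) ->
  walk_choosable 2 1 [:: x :: rcons c x].
Proof.
move=> /andP[_ /negPn oc] uq.
apply: (@cycles_walk_choosable 2 1 x [:: c]); rewrite //= ?cats0 //.
move=> C Lx [|lc [|? ?]] //= cLx /andP[uc _] [sc].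
have [|S fS pc] := even_cycle_pass cLx uc; rewrite ?sc //.
by exists S => // ls; rewrite inE => /eqP->.
Qed.

Lemma theta_even_walk_choosable u v w p2 p3 :
  odd (size p2) -> odd (size p3) -> uniq (u :: v :: flatten [:: [:: w]; p2; p3]) ->
  walk_choosable 4 2 [seq u :: rcons p v | p <- [:: [:: w]; p2; p3]].
Proof.
move=> o2 o3 uq; apply: theta_walk_choosable => //.
move=> C Lu Lv [|[|l [|? ?]] [|l2 [|l3 [|? ?]]]] //= cLu cLv.
move=> /and4P[/andP[/eqP cl _] u2 u3 _] [s2 s3].
have [||S [U [fS fU q1 q2 q3]]] := theta_even_pass cLu cLv cl u2 u3; rewrite ?s2 ?s3 //.
by exists S, U; split=> // ls; rewrite !inE => /or3P[] /eqP->.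
Qed.

Lemma theta_odd_walk_choosable u v p2 p3 :
  ~~ odd (size p2) -> ~~ odd (size p3) ->
  uniq (u :: v :: flatten [:: [::]; p2; p3]) ->
  walk_choosable 4 2 [seq u :: rcons p v | p <- [:: [::]; p2; p3]].
Proof.
move=> o2 o3 uq; apply: theta_walk_choosable => //.
move=> C Lu Lv [|[|? ?] [|l2 [|l3 [|? ?]]]] //= cLu cLv.
move=> /and3P[u2 u3 _] [] // s2 s3.
have [||S [U [fS fU q1 q2 q3]]] := theta_odd_pass cLu cLv u2 u3; rewrite ?s2 ?s3 //.
by exists S, U; split=> // ls; rewrite !inE => /or3P[] /eqP->.
Qed.

Lemma theta_2222_walk_choosable u v ps : shape ps = [:: 1; 1; 1; 1] ->
  uniq (u :: v :: flatten ps) -> walk_choosable 4 2 [seq u :: rcons p v | p <- ps].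
Proof.
move=> sh uq; apply: theta_walk_choosable => // C Lu Lv lss cLu cLv ul; rewrite sh => shl.
have sz : size lss = 4 by rewrite -(size_map size) -/(shape _) shl.
pose l (i : 'I_4) := head set0 (nth [::] lss i).
have lE ls : ls \in lss -> exists2 i, ls = [:: l i] & #|l i| = 4.
  move=> lsP; have lti : index ls lss < 4 by rewrite -sz index_mem.
  exists (Ordinal lti); rewrite /l /= nth_index //.
    have : size ls \in shape lss by apply: map_f.
    by rewrite shl !inE !orbb; case: (ls) => [|? []].
  have : size ls \in shape lss by apply: map_f.
  rewrite shl !inE !orbb; have := allP ul _ lsP.
  by case: (ls) => [|? [|? ?]] //= /andP[/eqP].
have cl i : #|l i| = 4.
  have ilt : i < size lss by rewrite sz.
  have [j E cj] := lE _ (mem_nth [::] ilt); by rewrite /l E.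
have [S [U [fS fU q]]] := theta_2222_pass cLu cLv cl.
by exists S, U; split=> // ls /lE[i -> _].
Qed.

Lemma theta_22_walk_choosable u v a b p : odd (size p) ->
  uniq (u :: v :: flatten [:: [:: a]; [:: b]; p]) ->
  walk_choosable 2 1 [seq u :: rcons p v | p <- [:: [:: a]; [:: b]; p]].
Proof.
move=> o3 uq; apply: theta_walk_choosable => //.
move=> C Lu Lv [|[|l1 [|? ?]] [|[|l2 [|? ?]] [|l3 [|? ?]]]] //= cLu cLv.
move=> /and4P[/andP[/eqP cl1 _] /andP[/eqP cl2 _] u3 _] [] s3.
have [|S [U [fS fU q1 q2 q3]]] := theta_22_pass cLu cLv cl1 cl2 u3; rewrite ?s3 //.
by exists S, U; split=> // ls; rewrite !inE => /or3P[] /eqP->.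
Qed.

(** Each arc of the large theta graph starts with a number [j] from [js] of copies of the list of
    [u], followed by an arc of the small one. As the numbers in [js] have one parity, all arcs of
    the small graph see the same colour set at their start. *)
Lemma theta_not_walk_choosable m u v ps lu lv bases js (o : bool) :
  uniq (u :: v :: flatten ps) ->
  all (fun l => size l == m.*2) (lu :: lv :: flatten bases) ->
  theta_blocked m lu lv bases ->
  all (fun j => odd j == o) js -> size js = size bases ->
  shape ps = [seq z.1 + size z.2 | z <- zip js bases] ->
  ~ walk_choosable m.*2 m [seq u :: rcons p v | p <- ps].
Proof.
move=> uq szs blk /allP js_o szj shp wch.
have /and4P[vu vv /allP vb _] := blk.
move: szs => /= /and3P[/eqP szu /eqP szv /allP szb].
pose lss := [seq nseq z.1 (colours lu) ++ map colours z.2 | z <- zip js bases].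
have [|||| L] := @labelling_exists T _ (fun l : {set 'I_6} => #|l| == m.*2) (colours lu)
    ([:: u] :: [:: v] :: ps) ([:: colours lu] :: [:: colours lv] :: lss) => //.
- rewrite /= shp /shape -map_comp; do 2!congr (_ :: _); apply: eq_map => z /=.
  by rewrite size_cat size_nseq size_map.
- by rewrite card_colours ?szu.
- rewrite /= !card_colours // szu szv !eqxx /=; apply/allP => ls /mapP[[j b] jb ->].
  have bb : b \in bases.
    have := map_f snd jb; rewrite -/(unzip2 _) unzip2_zip // szj //.
  apply/allP => l; rewrite mem_cat => /orP[/nseqP[-> _]|/mapP[l0 l0b ->]].
    by rewrite card_colours ?szu.
  rewrite card_colours ?szb //; last exact: allP (vb _ bb) _ l0b.
  by apply/flattenP; exists b.
move=> [= Lu Lv Lps] cL.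
rewrite (_ : [seq u :: rcons p v | p <- ps] = map (@arc_walk T) [seq (u, p, v) | p <- ps])
  in wch; last by rewrite -map_comp.
have [f fL pass] := walk_choosable_passable wch (fun v => eqP (cL v)).
have fu := fL u; have fv := fL v; rewrite Lu in fu; rewrite Lv in fv.
apply: (theta_prefix_blocked (o := o) szu blk fu fv) => b bb.
have /mapP[[j b'] jb /= Eb] : b \in unzip2 (zip js bases) by rewrite unzip2_zip // szj.
subst b'; exists j.
  by apply/eqP/js_o; have := map_f fst jb; rewrite -/(unzip1 _) unzip1_zip // szj.
have : nseq j (colours lu) ++ map colours b \in map (map L) ps.
  by rewrite Lps; apply/mapP; exists (j, b).
by case/mapP => p pps ->; apply/pass/map_f.
Qed.

Lemma theta_long_not_walk_choosable u v p1 p2 p3 :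
  1 < size p1 -> 1 < size p2 -> 1 < size p3 ->
  odd (size p2) = odd (size p1) -> odd (size p3) = odd (size p1) ->
  uniq (u :: v :: flatten [:: p1; p2; p3]) ->
  ~ walk_choosable 4 2 [seq u :: rcons p v | p <- [:: p1; p2; p3]].
Proof.
move=> s1 s2 s3 o2 o3 uq.
apply: (@theta_not_walk_choosable 2 u v _ _ _ theta_long_bases
  [:: size p1 - 2; size p2 - 2; size p3 - 2] (odd (size p1)) uq _ theta_long_blocked) => //=.
- by rewrite !oddB // o2 o3 addbF eqxx.
- by rewrite !subnK.
Qed.

Lemma theta_2222t_not_walk_choosable u v p1 p2 p3 p4 :
  size p1 = 1 -> size p2 = 1 -> size p3 = 1 -> 1 < size p4 -> odd (size p4) ->
  uniq (u :: v :: flatten [:: p1; p2; p3; p4]) ->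
  ~ walk_choosable 4 2 [seq u :: rcons p v | p <- [:: p1; p2; p3; p4]].
Proof.
move=> s1 s2 s3 s4 o4 uq; have s4' : 2 < size p4 by lia.
apply: (@theta_not_walk_choosable 2 u v _ _ _ theta_2222t_bases
  [:: 0; 0; 0; size p4 - 3] false uq _ theta_2222t_blocked) => //=.
- by rewrite oddB // o4.
- by rewrite s1 s2 s3 subnK.
Qed.

Lemma theta_short_not_walk_choosable u v p1 p2 p3 :
  1 < size p2 -> 1 < size p3 ->
  odd (size p2) = odd (size p1) -> odd (size p3) = odd (size p1) ->
  uniq (u :: v :: flatten [:: p1; p2; p3]) ->
  ~ walk_choosable 2 1 [seq u :: rcons p v | p <- [:: p1; p2; p3]].
Proof.
move=> s2 s3 o2 o3 uq.
apply: (@theta_not_walk_choosable 1 u v _ _ _ theta_short_bases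
  [:: size p1; size p2 - 2; size p3 - 2] (odd (size p1)) uq _ theta_short_blocked) => //=.
- by rewrite !oddB // o2 o3 addbF eqxx.
- by rewrite !subnK // addn0.
Qed.

Lemma theta_2222_not_walk_choosable u v ps : shape ps = [:: 1; 1; 1; 1] ->
  uniq (u :: v :: flatten ps) -> ~ walk_choosable 2 1 [seq u :: rcons p v | p <- ps].
Proof.
move=> sh uq.
by apply: (@theta_not_walk_choosable 1 u v _ _ _ theta_2222_bases
  [:: 0; 0; 0; 0] false uq _ theta_2222_blocked) => //=.
Qed.

End Families.

(** * Pairs of even cycles are not 2-choosable *)

(** Two lists which, closing an even cycle that otherwise carries the list [{0, 1}], exclude the
    colour [1 - n] at its root. *)
Definition forcing_base (n : nat) : seq (seq nat) :=
  if n is 0 then [:: [:: 0; 2]; [:: 1; 2]] else [:: [:: 1; 2]; [:: 0; 2]].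

Lemma fits_colours01 (S : {set 'I_6}) : fits 1 S (colours [:: 0; 1]) ->
  exists2 n, n < 2 & S = colours [:: n] /\ colours [:: 0; 1] :\: S = colours [:: 1 - n].
Proof.
move=> fS; have [//|s [s01 _ ->]] := fits_picks (s := [:: 0; 1]) _ fS.
move: s01; rewrite !inE => /orP[] /eqP->; [exists 0 | exists 1] => //; split=> //;
  by apply/setP => i; rewrite !inE; case: (val i) => [|[|]].
Qed.

Lemma colours1_inj n n' : n < 2 -> n' < 2 -> colours [:: n] = colours [:: n'] -> n = n'.
Proof.
move=> ltn ltn' /setP /(_ (inord n)); rewrite !inE /= inordK; last by lia.
by rewrite eqxx => /esym /eqP.
Qed.

Lemma forcing_cycle n j S : n < 2 -> odd j -> fits 1 S (colours [:: 0; 1]) ->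
  passable 1 S (nseq j (colours [:: 0; 1]) ++ map colours (forcing_base n)) S ->
  S = colours [:: n].
Proof.
move=> ltn oj fS /(passable_nseq (m := 1)); rewrite card_colours // oj => /(_ erefl fS).
have [n' ltn' [ES ->]] := fits_colours01 fS; rewrite ES => pass.
suff: n' = n by move=> ->.
have /passable_passableb := pass.
case: n ltn {pass} => [|[|//]] _; case: n' ltn' {ES} => [|[|//]] _ //.
- by move/(_ isT isT).
- by move/(_ isT isT).
Qed.

(** With the list [{0, 1}] throughout, the two colours alternate along the path. *)
Lemma forced_path n j S U : n < 2 -> S = colours [:: n] ->
  fits 1 U (colours [:: 0; 1]) -> passable 1 S (nseq j (colours [:: 0; 1])) U ->
  U = colours [:: (if odd j then n else 1 - n)].
Proof.
move=> ltn ES fU; rewrite -[nseq _ _]cats0.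
have fS : fits 1 S (colours [:: 0; 1]).
  rewrite /fits ES card_colours ?eqxx ?andbT; last by case: (n) ltn => [|[|]].
  by apply/subsetP => i; rewrite !inE; case: (n) ltn => [|[|]] // _ ->; rewrite ?orbT.
move/(passable_nseq (m := 1)); rewrite card_colours // => /(_ erefl fS).
have [n' ltn' [-> EU]] := fits_colours01 fU.
have [n1 ltn1 [ES' EnS]] := fits_colours01 fS.
have E1 : n1 = n by apply: colours1_inj => //; rewrite -ES.
rewrite EnS ES E1 => pass.
have {}pass : disj (colours [:: if odd j then 1 - n else n]) (colours [:: n']).
  by case: pass => -[|//] _ /=; rewrite andbT; case: (odd j).
congr (colours [:: _]).
have := disj_disjointb _ pass.
case: (n) ltn => [|[|//]] _; case: (odd j); case: (n') ltn' => [|[|//]] _ //; by move/(_ isT).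
Qed.

Section CyclePairs.
Variable T : finType.
Implicit Types (x y : T) (c d p : seq T).

Lemma joined_cycles_not_walk_choosable x y c d p :
  even_cycle_length c -> even_cycle_length d -> uniq ((x :: c) ++ (y :: d) ++ p) ->
  ~ walk_choosable 2 1 [:: x :: rcons c x; y :: rcons d y; x :: rcons p y].
Proof.
move=> /andP[s3c evc] /andP[s3d evd] uq wch.
rewrite /= negbK in evc; rewrite /= negbK in evd.
pose L01 := colours [:: 0; 1].
have cL01 : #|L01| == 2 by rewrite card_colours.
have cb n : all (fun l : {set 'I_6} => #|l| == 2) (map colours (forcing_base n)).
  by case: n => [|n]; rewrite /= !card_colours.
have sb n : size (map colours (forcing_base n)) = 2 by case: n.
(* The cycle at [x] forces the colour 0 there; [n] is the opposite of the colour that the path then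
   forces at [y], and the cycle at [y] forces [n]. *)
pose n := if odd (size p) then 1 else 0.
have cns j : all (fun l : {set 'I_6} => #|l| == 2) (nseq j L01).
  by apply/allP => l /nseqP[-> _].
have cbn j k : all (fun l : {set 'I_6} => #|l| == 2)
    (nseq j L01 ++ map colours (forcing_base k)) by rewrite all_cat cns cb.
have [|||L] := @labelling_exists T _ (fun l : {set 'I_6} => #|l| == 2) L01
    [:: [:: x]; c; [:: y]; d; p]
    [:: [:: L01]; nseq (size c - 2) L01 ++ map colours (forcing_base 0);
     [:: L01]; nseq (size d - 2) L01 ++ map colours (forcing_base n);
     nseq (size p) L01] _ _ cL01.
- by uniq_from uq.
- by rewrite /shape /= !size_cat !size_nseq ?sb /= !subnK.
- by apply/and5P; split; [|exact: cbn| |exact: cbn|]; rewrite /= ?cns ?cL01.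
move=> [= Lx Lc Ly Ld Lp] cL.
have [f fL pass] := walk_choosable_passable
  (wch : walk_choosable 2 1 (map (@arc_walk T) [:: (x, c, x); (y, d, y); (x, p, y)]))
  (fun v => eqP (cL v)).
have fx := fL x; have fy := fL y; rewrite Lx in fx; rewrite Ly in fy.
have px := pass x c x; rewrite Lc inE eqxx in px.
have py := pass y d y; rewrite Ld !inE eqxx orbT in py.
have pp := pass x p y; rewrite Lp !inE eqxx !orbT in pp.
have ltn2 : n < 2 by rewrite /n; case: ifP.
have Ex := forcing_cycle (n := 0) isT _ fx (px isT).
have Ey := forcing_cycle ltn2 _ fy (py isT).
have oc : odd (size c - 2) by rewrite oddB ?evc //; lia.
have od : odd (size d - 2) by rewrite oddB ?evd //; lia.
have := forced_path (n := 0) isT (Ex oc) fy (pp isT); rewrite Ey // /n.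
by case: (odd (size p)) => /colours1_inj; move/(_ isT isT).
Qed.

(** One cycle forces the colour 0 at [x], the other forces the colour 1. *)
Lemma sharing_cycles_not_walk_choosable x c d :
  even_cycle_length c -> even_cycle_length d -> uniq (x :: c ++ d) ->
  ~ walk_choosable 2 1 [:: x :: rcons c x; x :: rcons d x].
Proof.
move=> /andP[s3c evc] /andP[s3d evd] uq wch.
rewrite /= negbK in evc; rewrite /= negbK in evd.
pose L01 := colours [:: 0; 1].
have cL01 : #|L01| == 2 by rewrite card_colours.
have cb n : all (fun l : {set 'I_6} => #|l| == 2) (map colours (forcing_base n)).
  by case: n => [|n]; rewrite /= !card_colours.
have sb n : size (map colours (forcing_base n)) = 2 by case: n.
have cns j : all (fun l : {set 'I_6} => #|l| == 2) (nseq j L01).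
  by apply/allP => l /nseqP[-> _].
have cbn j k : all (fun l : {set 'I_6} => #|l| == 2)
    (nseq j L01 ++ map colours (forcing_base k)) by rewrite all_cat cns cb.
have [|||L] := @labelling_exists T _ (fun l : {set 'I_6} => #|l| == 2) L01
    [:: [:: x]; c; d]
    [:: [:: L01]; nseq (size c - 2) L01 ++ map colours (forcing_base 0);
     nseq (size d - 2) L01 ++ map colours (forcing_base 1)] _ _ cL01.
- by uniq_from uq.
- by rewrite /shape /= !size_cat !size_nseq ?sb /= !subnK.
- by apply/and3P; split; [|exact: cbn|apply/andP; split=> //; exact: cbn]; rewrite /= cL01.
move=> [= Lx Lc Ld] cL.
have [f fL pass] := walk_choosable_passable
  (wch : walk_choosable 2 1 (map (@arc_walk T) [:: (x, c, x); (x, d, x)]))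
  (fun v => eqP (cL v)).
have fx := fL x; rewrite Lx in fx.
have px := pass x c x; rewrite Lc inE eqxx in px.
have py := pass x d x; rewrite Ld !inE eqxx orbT in py.
have oc : odd (size c - 2) by rewrite oddB ?evc //; lia.
have od : odd (size d - 2) by rewrite oddB ?evd //; lia.
have Ex := forcing_cycle (n := 0) isT oc fx (px isT).
have := forcing_cycle (n := 1) isT od fx (py isT); rewrite Ex.
by move/colours1_inj => /(_ isT isT).
Qed.

End CyclePairs.

(** * The listed graphs are (4:2)-choosable *)

Section Sufficiency.
Variable G : sgraph.

Lemma theta_choosable (ls : seq nat) : theta ls G ->
  (forall u v (ps : seq (seq G)), [seq (size p).+1 | p <- ps] = ls ->
     uniq (u :: v :: flatten ps) -> walk_choosable 4 2 [seq u :: rcons p v | p <- ps]) ->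
  choosable 4 2 G.
Proof.
move=> [u [v [ps [sz _ uq un]]]] wch; apply: walk_choosable_choosable un _; exact: wch.
Qed.

Lemma family_choosable :
  [\/ two_even_cycles_joined_by_path G,
      two_even_cycles_sharing_vertex G,
      exists s t : nat, [/\ 1 < s, 1 < t &
        theta [:: 2; 2 * s; 2 * t] G \/
        theta [:: 1; 2 * s - 1; 2 * t - 1] G]
    | theta [:: 2; 2; 2; 2] G] -> choosable 4 2 G.
Proof.
case.
- move=> [x [y [c [d [p [evc evd uq un]]]]]].
  by apply: walk_choosable_choosable un _; apply: joined_cycles_walk_choosable.
- move=> [x [c [d [evc evd uq un]]]].
  by apply: walk_choosable_choosable un _; apply: sharing_cycles_walk_choosable.
- move=> [s [t [s1 t1 [th|th]]]]; apply: theta_choosable th _ => u v.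
  + move=> [|[|w [|? ?]] [|p2 [|p3 [|? ?]]]] //= [s2 s3] uq.
    by apply: theta_even_walk_choosable => //; lia.
  + move=> [|[|? ?] [|p2 [|p3 [|? ?]]]] //= [s2 s3] uq.
    by apply: theta_odd_walk_choosable => //; lia.
- move=> th; apply: theta_choosable th _ => u v ps sz uq.
  apply: theta_2222_walk_choosable => //.
  by move: sz; case: ps {uq} => [|p1 [|p2 [|p3 [|p4 [|? ?]]]]] //= [-> -> -> ->].
Qed.

End Sufficiency.

(** * Critical graphs *)

(** When all lists are the same four colours, adjacent vertices receive complementary pairs;
    containing a fixed colour is then a proper 2-colouring. *)
Lemma choosable_42_bipartite (G : sgraph) : choosable 4 2 G ->
  exists h : G -> bool, forall x y, edge x y -> h y = ~~ h x.
Proof.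
move=> chG; have [|f [fL fd]] := chG 'I_4 (fun=> setT); first by rewrite cardsT card_ord.
exists (fun v => ord0 \in f v) => x y /fd dxy.
have : f x :|: f y == setT.
  rewrite eqEcard subsetT cardsT card_ord cardsU dxy cards0.
  by have [_ ->] := fL x; have [_ ->] := fL y.
move/eqP/setP/(_ ord0); move/setP/(_ ord0): dxy; rewrite !inE.
by case: (ord0 \in f x); case: (ord0 \in f y).
Qed.

Section Critical.
Variable G : sgraph.
Hypothesis Gcrit : three_choosable_critical G.

Lemma critical_delete (K : {set G}) z : z \in K ->
  forall (C : finType) (L : G -> {set C}), (forall v, #|L v| = 2) ->
  exists2 f : G -> {set C}, forall v, fits 1 (f v) (L v)
    & forall x y, x \notin K -> y \notin K -> edge x y -> disj (f x) (f y).
Proof.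
move=> zK C L cL.
pose e := [rel x y : G | [&& x \in ~: K, y \in ~: K & edge x y]].
have es : symmetric e by move=> x y; rewrite /= edge_sym andbCA.
pose H := @Subgraph G (~: K) e es (fun x y h => h).
have [|f [fL fd]] := (Gcrit.2 H _) C (fun v => L (val v)) (fun v => cL _).
  by left; apply/eqP => /setP /(_ z); rewrite !inE zK.
have [g gL] := default_colouring (isT : 1 <= 2) cL.
exists (fun v => if insub v is Some v' then f v' else g v) => [v | x y xK yK exy].
  case: insubP => [v' _ <- | _ //]; have [fv cv] := fL v'; by rewrite /fits fv cv eqxx.
have xH : x \in sub_verts H by rewrite inE.
have yH : y \in sub_verts H by rewrite inE.
rewrite (insubT (fun z => z \in sub_verts H) xH) (insubT (fun z => z \in sub_verts H) yH).
by rewrite /disj -setI_eq0 fd // /= /graph_sub_edge /= !inE xK yK.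
Qed.

(** Minimum degree two, in the form that extends a path. If [y] were the only possible neighbour,
    [x] could be deleted and coloured last, since [y] takes at most one of its two colours. *)
Lemma critical_neighbour (x y : G) : exists2 z, z != y & edge x z.
Proof.
case: (boolP [exists z, (z != y) && edge x z]) => [/existsP[z /andP[]] | /existsPn nz].
  by exists z.
case: Gcrit => nch _; case: nch => C L cL.
have [f fL fd] := critical_delete (set11 x) cL.
have [|S SL cS] := @subset_of_card C (L x :\: f y) 1.
  have := cardsID (f y) (L x); rewrite cL; have /andP[_ /eqP cfy] := fL y.
  have := subset_leq_card (subsetIr (L x) (f y)); rewrite cfy; lia.
have /subsetDP[SLx dS] := SL.
exists (fun v => if v == x then S else f v); split=> [v | u v].
  case: eqP => [-> // | _]; by have /andP[-> /eqP] := fL v.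
move=> euv; apply/eqP; rewrite setI_eq0.
have ndx v' : edge x v' -> v' = y by move=> e1; have := nz v'; rewrite e1 andbT negbK => /eqP.
case: (eqVneq u x) => [Eu|nu]; case: (eqVneq v x) => [Ev|nv].
- by move: euv; rewrite Eu Ev edge_irr.
- by rewrite Eu in euv; rewrite (ndx _ euv).
- by rewrite Ev edge_sym in euv; rewrite (ndx _ euv) disjoint_sym.
- by apply: fd => //; rewrite inE.
Qed.

Lemma critical_inhabited : exists x : G, true.
Proof.
case: (pickP (@predT G)) => [x _|no]; first by exists x.
case: Gcrit => nch _; case: nch => C L cL; exists L.
by split=> [v|u v]; [have := no v | have := no u].
Qed.

Definition part_choosable (V : seq G) (r : rel G) :=
  forall (C : finType) (L : G -> {set C}), (forall v, #|L v| = 2) ->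
  exists2 f : G -> {set C}, forall v, fits 1 (f v) (L v)
    & forall x y, x \in V -> r x y -> disj (f x) (f y).

(** Otherwise all edges at [V] belong to [r] and stay inside [V]; a colouring of [V] and one of the
    rest, which exists by criticality, would together colour the whole graph. *)
Lemma critical_extra_edge (V : seq G) (r : rel G) z : z \in V ->
  (forall x y, x \in V -> r x y -> y \in V) -> part_choosable V r ->
  exists x y, [/\ x \in V, edge x y & ~~ r x y].
Proof.
move=> zV rV rch.
case: (boolP [exists e : G * G, [&& e.1 \in V, edge e.1 e.2 & ~~ r e.1 e.2]]).
  by case/existsP => -[x y] /and3P[]; exists x, y.
move/existsPn => no.
have er x y : x \in V -> edge x y -> r x y.
  by move=> xV exy; have := no (x, y); rewrite /= xV exy negbK.
case: Gcrit => nch _; case: nch => C L cL.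
have zV' : z \in [set x in V] by rewrite inE.
have [f fL fd] := critical_delete zV' cL; have [g gL gd] := rch C L cL.
exists (fun v => if v \in V then g v else f v); split=> [v | x y exy].
  by case: ifP => _; [have /andP[-> /eqP] := gL v | have /andP[-> /eqP] := fL v].
apply/eqP; rewrite setI_eq0; case: ifP => xV; case: ifP => yV.
- exact: gd xV (er _ _ xV exy).
- by rewrite (rV _ _ xV (er _ _ xV exy)) in yV.
- by rewrite edge_sym in exy; rewrite (rV _ _ yV (er _ _ yV exy)) in xV.
- by apply: fd; rewrite ?inE ?xV ?yV.
Qed.

Definition outside (V q : seq G) := all (fun z => z \notin V) q.

(** An ear with [x = y] is a cycle attached at one vertex; the condition on [size q = 1] excludes
    going along an edge and back. A lollipop is a path leaving [V] with a cycle at its far end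
    [z]. *)
Variant ear_spec (V : seq G) (r : rel G) : Prop :=
| Ear x y q of x \in V & y \in V & path (@edge G) x (rcons q y) & uniq q & outside V q
    & (q = [::] -> ~~ r x y) & (size q = 1 -> x != y)
| Lollipop x q z c of x \in V & path (@edge G) x (rcons q z) & path (@edge G) z (rcons c z)
    & uniq (q ++ z :: c) & outside V (q ++ z :: c) & 1 < size c.

(** Take a longest path that starts at [x] and otherwise avoids [V]. Its last vertex has a neighbour
    other than its predecessor, which lies either in [V], giving an ear, or on the path, giving a
    lollipop. *)
Lemma ear_exists (V : seq G) (r : rel G) z0 : z0 \in V ->
  (forall x y, x \in V -> r x y -> y \in V) -> part_choosable V r -> ear_spec V r.
Proof.
move=> zV rV rch; have [x [y [xV exy nrxy]]] := critical_extra_edge zV rV rch.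
case: (boolP (y \in V)) => [yV | yV]; first by apply: (@Ear _ _ x y [::]); rewrite //= ?exy.
pose good q := [&& path (@edge G) x q, uniq q & outside V q].
pose P n := [exists t : n.-tuple G, good t].
have P1 : exists n, P n.
  by exists 1; apply/existsP; exists [tuple y]; rewrite /good /= exy yV.
have bnd n : P n -> n <= #|G|.
  move/existsP => [t /and3P[_ ut _]]; rewrite -(size_tuple t) -(card_uniqP ut).
  exact: max_card.
case: (ex_maxnP P1 bnd) => n /existsP[t gt] maxn.
have max q : good q -> size q <= size t.
  move=> gq; rewrite size_tuple; apply: maxn; apply/existsP.
  by exists (in_tuple q).
have : 0 < size t.
  by apply: (@leq_trans (size [:: y])) => //; apply: max; rewrite /good /= exy yV.
move: (val t : seq G) gt max => {P P1 bnd n maxn t}s.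
case/lastP: s => [//|q z] /and3P[pq uq oq] max _.
have [z' nz' ezz'] := critical_neighbour z (last x q).
have pqz' : path (@edge G) x (rcons (rcons q z) z') by rewrite rcons_path pq last_rcons.
case: (boolP (z' \in V)) => [z'V | z'V].
  apply: (@Ear _ _ x z' (rcons q z)) => //; first by case: (q).
  by rewrite size_rcons => -[/size0nil Eq]; rewrite Eq /= in nz'; rewrite eq_sym.
have z'q : z' \in rcons q z.
  apply/negPn/negP => nz'q; have := max (rcons (rcons q z) z').
  rewrite [size (rcons _ z')]size_rcons ltnn => /(_ _) h; apply: notF; apply: h.
  by rewrite /good pqz' rcons_uniq nz'q uq /outside all_rcons z'V.
have {}z'q : z' \in q.
  move: z'q; rewrite mem_rcons inE => /orP[/eqP E | //].
  by rewrite E edge_irr in ezz'.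
case/splitPr: z'q pq uq oq nz' pqz' {max} => q1 q2 pq uq oq nz' pqz'.
(* As [z'] is not the predecessor of [z], the closed walk is a genuine cycle. *)
have nq2 : q2 != [::].
  by apply: contra nz' => /eqP->; rewrite last_cat.
apply: (@Lollipop _ _ x q1 z' (rcons q2 z)) => //.
- by move: pq; rewrite rcons_cat cat_path /= => /and3P[h1 h2 _]; rewrite rcons_path h1.
- move: pqz'; rewrite !rcons_cat cat_path => /andP[_]; by rewrite rcons_cons => /= /andP[].
- by move: uq; rewrite rcons_cat.
- by move: oq; rewrite rcons_cat.
- by rewrite size_rcons; case: (q2) nq2.
Qed.

End Critical.

(** * Graphs that are both critical and (4:2)-choosable *)

Section Structure.
Variable G : sgraph.
Hypotheses (Gcrit : three_choosable_critical G) (Gch : choosable 4 2 G).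
Implicit Types (x y z u v : G) (p q c d R : seq G) (ps : seq (seq G)).

Local Notation walk := (path (@edge G)).

Lemma walk_cat x p y q z :
  walk x (rcons (p ++ y :: q) z) = walk x (rcons p y) && walk y (rcons q z).
Proof. by rewrite -cat_rcons rcons_cat cat_path last_rcons. Qed.

Lemma walk_rev x p y : walk x (rcons p y) -> walk y (rcons (rev p) x).
Proof.
have := rev_path (@edge G) x (rcons p y); rewrite last_rcons belast_rcons rev_cons => ->.
by rewrite (@eq_path _ _ (@edge G)) // => a b; rewrite edge_sym.
Qed.

Lemma walk_parity (h : G -> bool) : (forall x y, edge x y -> h y = ~~ h x) ->
  forall p x, walk x p -> h (last x p) = h x (+) odd (size p).
Proof.
move=> hE; elim=> [|y p IHp] x /=; first by rewrite addbF.
by case/andP => /hE hy /IHp ->; rewrite hy addNb addbN.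
Qed.

Lemma walks_same_parity x y p q : walk x (rcons p y) -> walk x (rcons q y) ->
  odd (size p) = odd (size q).
Proof.
have [h hE] := choosable_42_bipartite Gch.
move=> /(walk_parity hE) + /(walk_parity hE); rewrite !last_rcons !size_rcons /= => -> /addbI.
exact: negb_inj.
Qed.

Lemma closed_walk_odd x c : walk x (rcons c x) -> odd (size c).
Proof.
have [h hE] := choosable_42_bipartite Gch.
move=> /(walk_parity hE); rewrite last_rcons size_rcons /=.
by case: (h x); case: (odd _).
Qed.

Lemma closed_walk_even_cycle x c : walk x (rcons c x) -> 1 < size c -> even_cycle_length c.
Proof. by move=> /closed_walk_odd oc sc; rewrite /even_cycle_length ltnS sc /= oc. Qed.

Definition listed : Prop :=
  [\/ two_even_cycles_joined_by_path G,
      two_even_cycles_sharing_vertex G,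
      exists s t : nat, [/\ 1 < s, 1 < t &
        theta [:: 2; 2 * s; 2 * t] G \/
        theta [:: 1; 2 * s - 1; 2 * t - 1] G]
    | theta [:: 2; 2; 2; 2] G].

Lemma joined_listed x y c d p : walk x (rcons c x) -> walk y (rcons d y) ->
  walk x (rcons p y) -> 1 < size c -> 1 < size d ->
  uniq ((x :: c) ++ (y :: d) ++ p) -> listed.
Proof.
move=> wc wd wp sc sd uq; apply: Or41; exists x, y, c, d, p.
have ec := closed_walk_even_cycle wc sc; have ed := closed_walk_even_cycle wd sd.
split=> //; apply: critical_union_of_walks => //; first by rewrite /= wc wd wp.
exact: joined_cycles_not_walk_choosable.
Qed.

Lemma sharing_listed x c d : walk x (rcons c x) -> walk x (rcons d x) ->
  1 < size c -> 1 < size d -> uniq (x :: c ++ d) -> listed.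
Proof.
move=> wc wd sc sd uq; apply: Or42; exists x, c, d.
have ec := closed_walk_even_cycle wc sc; have ed := closed_walk_even_cycle wd sd.
split=> //; apply: critical_union_of_walks => //; first by rewrite /= wc wd.
exact: sharing_cycles_not_walk_choosable.
Qed.

Definition theta_in u v ps :=
  [&& uniq (u :: v :: flatten ps), uniq ps & all (fun p => walk u (rcons p v)) ps].

Lemma theta_in_walks u v ps : theta_in u v ps ->
  all (sorted (@edge G)) [seq u :: rcons p v | p <- ps].
Proof. by case/and3P => _ _ wps; rewrite all_map. Qed.

Lemma theta_in_perm u v ps ps' : perm_eq ps ps' -> theta_in u v ps -> theta_in u v ps'.
Proof.
move=> pp; rewrite /theta_in (perm_uniq pp) (perm_all _ pp).
suff /perm_uniq-> : perm_eq (u :: v :: flatten ps) (u :: v :: flatten ps') by [].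
by rewrite !perm_cons; apply: perm_flatten.
Qed.

Lemma theta_in_rev u v ps : theta_in u v ps -> theta_in v u (map rev ps).
Proof.
case/and3P => uq ups /allP wps; apply/and3P; split.
- suff /perm_uniq-> : perm_eq (v :: u :: flatten (map rev ps)) (u :: v :: flatten ps) by [].
  apply/permP => a /=; rewrite addnCA; congr (_ + (_ + _)).
  by elim: (ps) => //= p ps' IH; rewrite !count_cat count_rev IH.
- by rewrite map_inj_uniq //; apply: can_inj (@revK G).
- by apply/allP => p' /mapP[p /wps wp ->]; apply: walk_rev.
Qed.

Lemma theta0_listed u v p2 p3 : theta_in u v [:: [::]; p2; p3] -> listed.
Proof.
move=> th; have /and3P[uq ups /allP wps] := th.
have w1 := wps [::] (mem_head _ _).
have w2 : walk u (rcons p2 v) by apply: wps; rewrite !inE eqxx orbT.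
have w3 : walk u (rcons p3 v) by apply: wps; rewrite !inE eqxx !orbT.
have o2 : odd (size p2) = false := walks_same_parity w2 w1.
have o3 : odd (size p3) = false := walks_same_parity w3 w1.
have [s2 s3] : 1 < size p2 /\ 1 < size p3.
  move: ups o2 o3; rewrite /= !inE !negb_or; case: (p2) => [|? [|? ?]] //=.
  by case: (p3) => [|? [|? ?]].
(* A path with [2n] inner vertices has [2n + 1 = 2(n + 1) - 1] edges. *)
apply: Or43; exists (size p2)./2.+1, (size p3)./2.+1.
have e2 := odd_double_half (size p2); have e3 := odd_double_half (size p3).
split; [lia | lia | right; exists u, v, [:: [::]; p2; p3]; split=> //].
  by rewrite /=; congr [:: _; _; _]; lia.
apply: critical_union_of_walks => //; first exact: theta_in_walks.
by apply: theta_short_not_walk_choosable.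
Qed.

Lemma theta1_listed u v w p2 p3 : theta_in u v [:: [:: w]; p2; p3] ->
  1 < size p2 -> 1 < size p3 -> listed.
Proof.
move=> th s2 s3; have /and3P[uq ups /allP wps] := th.
have w1 := wps [:: w] (mem_head _ _).
have w2 : walk u (rcons p2 v) by apply: wps; rewrite !inE eqxx orbT.
have w3 : walk u (rcons p3 v) by apply: wps; rewrite !inE eqxx !orbT.
have o2 : odd (size p2) = true := walks_same_parity w2 w1.
have o3 : odd (size p3) = true := walks_same_parity w3 w1.
apply: Or43; exists (size p2)./2.+1, (size p3)./2.+1.
have e2 := odd_double_half (size p2); have e3 := odd_double_half (size p3).
split; [lia | lia | left; exists u, v, [:: [:: w]; p2; p3]; split=> //].
  by rewrite /=; congr [:: _; _; _]; lia.
apply: critical_union_of_walks => //; first exact: theta_in_walks.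
by apply: theta_short_not_walk_choosable.
Qed.

(** By the number of inner vertices of the shortest arc: none gives a listed graph; one gives a
    listed graph or Theta_{2,2,2p}; two or more contradict (4:2)-choosability. *)
Lemma theta_cases u v ps : size ps = 3 -> theta_in u v ps ->
  listed \/ exists a b p, theta_in u v [:: [:: a]; [:: b]; p].
Proof.
move=> sz th; pose le p q := size p <= size q.
have le_total : total le by move=> p q; apply: leq_total.
have pp : perm_eq ps (sort le ps) by rewrite perm_sym; apply/permPl/perm_sort.
have := sort_sorted le_total ps; have := theta_in_perm pp th.
have := size_sort le ps; rewrite sz.
case: (sort le ps) => [|p1 [|p2 [|p3 [|? ?]]]] // _ {}th /and3P[le12 le23 _].
have /and3P[uq ups /and4P[w1 w2 w3 _]] := th.
rewrite /le in le12 le23.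
have o2 := walks_same_parity w2 w1; have o3 := walks_same_parity w3 w1.
case: (p1) th w1 uq ups o2 o3 le12 => [|a [|a' p1']] th w1 uq ups o2 o3 le12.
- by left; apply: theta0_listed th.
- case: (ltnP 1 (size p2)) => s2.
    by left; apply: theta1_listed th _ _ => //; apply: leq_trans le23.
  right; case: (p2) th s2 le12 => [|b [|? ?]] // th _ _.
  by exists a, b, p3.
- have [] := @theta_long_not_walk_choosable _ u v (a :: a' :: p1') p2 p3 => //.
  + exact: leq_trans le12.
  + by apply: leq_trans le23; apply: leq_trans le12.
  + exact: choosable_walk_choosable Gch (theta_in_walks th).
Qed.

Definition proper_ear (V : seq G) (r : rel G) x y q :=
  [/\ x != y, x \in V /\ y \in V, walk x (rcons q y), uniq q /\ outside V q
    & q = [::] -> ~~ r x y].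

Lemma proper_ear_sym V r x y q : symmetric r ->
  proper_ear V r x y q -> proper_ear V r y x (rev q).
Proof.
move=> rs [nxy [xV yV] wq [uq oq] nr]; split=> //.
- by rewrite eq_sym.
- exact: walk_rev.
- by rewrite rev_uniq /outside all_rev.
- by rewrite rs => /(congr1 rev); rewrite revK => /nr.
Qed.

Lemma outside_uniq (V q : seq G) : uniq V -> uniq q -> outside V q -> uniq (V ++ q).
Proof.
move=> uV uq /allP oq; rewrite cat_uniq uV uq andbT; apply/hasPn => z /oq.
by [].
Qed.

Lemma outside_sub (V V' q : seq G) : {subset V' <= V} -> outside V q -> outside V' q.
Proof.
by move=> sV /allP oq; apply/allP => z /oq; apply: contra => /sV.
Qed.

(** Every vertex of [V] lies on a cycle inside [V], so a closed ear or a lollipop yields two cycles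
    that share a vertex or are joined by a path; only ears with distinct ends remain. *)
Lemma ear_listed (V : seq G) (r : rel G) z0 : z0 \in V ->
  (forall x y, x \in V -> r x y -> y \in V) -> part_choosable V r ->
  (forall x, x \in V -> exists c, [/\ walk x (rcons c x), 1 < size c, uniq (x :: c)
     & {subset x :: c <= V}]) ->
  listed \/ exists x y q, proper_ear V r x y q.
Proof.
move=> zV rV rch cyc; case: (ear_exists Gcrit zV rV rch).
- move=> x y q xV yV wq uq oq nr nxy1; case: (eqVneq x y) => [Exy|nxy].
    subst y; left; have [c [wc sc uc cV]] := cyc x xV.
    apply: (sharing_listed wc wq sc).
      case: (q) wq nxy1 => [|? [|? ?]] //=; first by rewrite edge_irr.
      by move=> _ /(_ erefl); rewrite eqxx.
    by rewrite -cat_cons; apply: outside_uniq uc uq (outside_sub cV oq).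
  by right; exists x, y, q.
- move=> x q z d xV wq wd uqd oqd sd; left; have [c [wc sc uc cV]] := cyc x xV.
  apply: (joined_listed wc wd wq sc sd).
  have := outside_uniq uc uqd (outside_sub cV oqd) => uall.
  by uniq_from uall.
Qed.

Lemma cycle_rooted (s : seq G) x : cycle (@edge G) s -> uniq s -> x \in s ->
  exists c, [/\ walk x (rcons c x), uniq (x :: c), x :: c =i s, size c = (size s).-1
    & next (x :: c) =1 next s].
Proof.
move=> cs us /rot_to[i c Ec]; exists c; split.
- by have : cycle (@edge G) (x :: c) by rewrite -Ec rot_cycle.
- by rewrite -Ec rot_uniq.
- by move=> z; rewrite -Ec mem_rot.
- by rewrite -(size_rot i s) Ec.
- by rewrite -Ec; apply: next_rot.
Qed.

Lemma part_choosable_walks (V : seq G) (ws : seq (seq G)) :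
  walk_choosable 2 1 ws -> part_choosable V (walks_edge ws).
Proof.
move=> wch C L cL; have [f fL /allP fd] := wch C L cL; exists f => // x y _.
case/hasP => w /fd; rewrite sorted_map => sw /orP[] /(sorted_infix2 sw) //=.
by rewrite disj_sym.
Qed.

Lemma closed_arcs u v ps R R2 : theta_in u v (R :: R2 :: ps) ->
  cycle (@edge G) (u :: R ++ v :: rev R2) /\ uniq (u :: R ++ v :: rev R2).
Proof.
case/and3P => uq _ /and3P[w1 w2 _]; split; last by uniq_from uq.
by rewrite /= walk_cat w1 /= walk_rev.
Qed.

Lemma theta_cycle_through u v R R2 R3 x : theta_in u v [:: R; R2; R3] ->
  x \in u :: v :: R -> exists c, [/\ walk x (rcons c x), 1 < size c, uniq (x :: c)
     & {subset x :: c <= u :: v :: R ++ R2 ++ R3}].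
Proof.
move=> th xR; have [cs us] := closed_arcs th.
have xs : x \in u :: R ++ v :: rev R2.
  by move: xR; rewrite !(inE, mem_cat); case/or3P => ->; rewrite ?orbT.
have [c [wc uc cE sc _]] := cycle_rooted cs us xs; exists c; split=> //.
  rewrite sc /= size_cat /= size_rev addnS ltnS; case/and3P: th => _ + _.
  by case: (R) (R2) => [|? ?] [|? ?].
move=> z; rewrite cE !(inE, mem_cat, mem_rev).
by case/or4P => ->; rewrite ?orbT.
Qed.

(** The ear and the part of the arc from [x] to [v] form a cycle that meets the cycle of the two
    other arcs in [v] only. *)
Lemma same_arc_end_listed u v R2 R3 x q r1 r2 :
  theta_in u v [:: r1 ++ x :: r2; R2; R3] -> walk x (rcons q v) -> uniq q ->
  outside (u :: v :: flatten [:: r1 ++ x :: r2; R2; R3]) q -> 0 < size r2 + size q ->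
  listed.
Proof.
move=> th wq uq oq sq; have /and3P[uV ups /and4P[w1 w2 w3 _]] := th.
have uall := outside_uniq uV uq oq.
have /andP[_ wr2] : walk u (rcons r1 x) && walk x (rcons r2 v) by rewrite -walk_cat.
apply: (@sharing_listed v (rev r2 ++ x :: q) (rev R2 ++ u :: R3)).
- by rewrite walk_cat walk_rev.
- by rewrite walk_cat walk_rev.
- by rewrite size_cat size_rev /=; lia.
- rewrite size_cat size_rev /= addnS ltnS.
  by move: ups; case: (R2) (R3) => [|? ?] [|? ?] //=; rewrite ?andbF.
- by uniq_from uall.
Qed.

(** The ear closes a cycle with the part of the arc between [x] and [y]; the part [r1] joins it to
    the cycle of the two other arcs. *)
Lemma same_arc_listed u v R2 R3 x y q r1 r2 r3 :
  theta_in u v [:: r1 ++ x :: r2 ++ y :: r3; R2; R3] -> walk x (rcons q y) -> uniq q ->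
  outside (u :: v :: flatten [:: r1 ++ x :: r2 ++ y :: r3; R2; R3]) q ->
  0 < size r2 + size q -> listed.
Proof.
move=> th wq uq oq sq; have /and3P[uV ups /and4P[w1 w2 w3 _]] := th.
have uall := outside_uniq uV uq oq.
have /and3P[wr1 wr2 _] : [&& walk u (rcons r1 x), walk x (rcons r2 y) & walk y (rcons r3 v)].
  by rewrite -!walk_cat.
apply: (@joined_listed x u (r2 ++ y :: rev q) (R2 ++ v :: rev R3) (rev r1)).
- by rewrite walk_cat wr2 walk_rev.
- by rewrite walk_cat w2 walk_rev.
- exact: walk_rev.
- by rewrite size_cat /= size_rev; lia.
- rewrite size_cat /= size_rev addnS ltnS.
  by move: ups; case: (R2) (R3) => [|? ?] [|? ?] //=; rewrite ?andbF.
- by uniq_from uall.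
Qed.

(** Leaving out [r1] gives a theta graph with ends [x] and [v]: the edge [xv], the path through [u]
    and [R3], and the path along the ear and [r2]. *)
Lemma cross_arcs_listed u v x y q r1 r2 R3 :
  theta_in u v [:: [:: x]; r1 ++ y :: r2; R3] -> walk x (rcons q y) -> uniq q ->
  outside (u :: v :: flatten [:: [:: x]; r1 ++ y :: r2; R3]) q -> listed.
Proof.
move=> th wq uq oq; have /and3P[uV ups /and4P[w1 w2 w3 _]] := th.
have uall := outside_uniq uV uq oq.
have /andP[_ wr2] : walk u (rcons r1 y) && walk y (rcons r2 v) by rewrite -walk_cat.
have /andP[eux /andP[exv _]] := w1.
apply: (@theta0_listed x v (u :: R3) (q ++ y :: r2)); apply/and3P; split.
- by uniq_from uall.
- have un : uniq (u :: q ++ y :: r2) by uniq_from uall.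
  rewrite /= !inE andbT; apply/andP; split; first by case: (q).
  apply/eqP => E; move: un; rewrite -E /= mem_head //.
- by rewrite /= exv edge_sym eux w3 walk_cat wq wr2.
Qed.

Lemma perm3 ps R R' : uniq ps -> size ps = 3 -> R \in ps -> R' \in ps -> R != R' ->
  exists R3, perm_eq ps [:: R; R'; R3].
Proof.
move=> ups sz Rps R'ps nRR'; have pp := perm_to_rem Rps.
have R'r : R' \in rem R ps by rewrite mem_rem_uniq // inE eq_sym nRR'.
have pp' := perm_to_rem R'r.
have : size (rem R' (rem R ps)) = 1 by rewrite !size_rem // sz.
case E : (rem R' (rem R ps)) => [|R3 [|? ?]] // _; exists R3.
by rewrite E in pp'; apply: perm_trans pp _; rewrite perm_cons.
Qed.

(** * Ears of Theta_{2,2,2p} *)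

Section SmallTheta.
Variables (u v a b : G) (P : seq G).
Let ps := [:: [:: a]; [:: b]; P].
Hypothesis th : theta_in u v ps.

Let V := u :: v :: flatten ps.
Let r := walks_edge [seq u :: rcons p v | p <- ps].

Lemma small_theta_odd : odd (size P).
Proof.
have /and3P[_ _ /and4P[w1 _ w3 _]] := th.
by rewrite (walks_same_parity w3 w1).
Qed.

Lemma small_theta_closed x y : x \in V -> r x y -> y \in V.
Proof.
move=> _ /hasP[w /mapP[p pps ->]].
suff sub : {subset u :: rcons p v <= V}.
  by case/orP => /infix2_mem /andP[m1 m2]; apply: sub.
move=> z; rewrite in_cons mem_rcons in_cons => /or3P[/eqP->|/eqP->|zp].
- by rewrite mem_head.
- by rewrite in_cons mem_head orbT.
- have zps : z \in flatten ps by apply/flattenP; exists p.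
  by rewrite 2!in_cons zps !orbT.
Qed.

Lemma small_theta_ear : listed \/ exists x y q, proper_ear V r x y q.
Proof.
apply: (@ear_listed V r u); rewrite ?mem_head //.
- exact: small_theta_closed.
- apply: part_choosable_walks; apply: theta_22_walk_choosable small_theta_odd _.
  by case/and3P: th.
move=> x; rewrite 2!in_cons => xV.
have [R Rps xR] : exists2 R, R \in ps & x \in u :: v :: R.
  case/or3P: xV => [/eqP->|/eqP->|/flattenP[R Rps xR]]; first by exists [:: a]; rewrite mem_head.
    by exists [:: a]; rewrite !inE eqxx ?orbT.
  by exists R; rewrite // !inE xR !orbT.
have [R' R'ps nRR'] : exists2 R', R' \in ps & R != R'.
  have /and3P[_ ups _] := th.
  case: (eqVneq R [:: a]) => [->|nR]; last by exists [:: a]; rewrite ?mem_head.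
  exists [:: b]; first by rewrite !inE eqxx orbT.
  by move: ups; rewrite /= !inE !negb_or => /andP[/andP[]].
have /and3P[_ ups _] := th.
have [R3 pp] := perm3 ups erefl Rps R'ps nRR'.
have [c [wc sc uc cV]] := theta_cycle_through (theta_in_perm pp th) xR.
exists c; split=> // z /cV; rewrite 4!in_cons => /or3P[->|->|zR]; rewrite ?orbT //.
by rewrite (perm_mem (perm_flatten pp)) /= cats0 zR !orbT.
Qed.

Lemma small_theta_inner_ear x y q : x \in flatten ps -> proper_ear V r x y q -> listed.
Proof.
have /and3P[uV ups _] := th.
have rs : symmetric r := @walks_edge_sym _ _.
have rwalk R s1 s2 z t : R \in ps -> u :: rcons R v = s1 ++ [:: z; t] ++ s2 -> r z t.
  move=> Rps E; apply/hasP; exists (u :: rcons R v); first exact: map_f.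
  by apply/orP; left; apply/infixP; exists s1, s2.
have Vsub pps : perm_eq ps pps -> {subset u :: v :: flatten pps <= V}.
  by move=> pp z; rewrite 4!in_cons -(perm_mem (perm_flatten pp)).
move=> /flattenP[R Rps xR] ear.
have [R' R'ps nRR'] : exists2 R', R' \in ps & R != R'.
  case: (eqVneq R [:: a]) => [->|nR]; last by exists [:: a]; rewrite ?mem_head.
  exists [:: b]; first by rewrite !inE eqxx orbT.
  by move: ups; rewrite /= !inE !negb_or => /andP[/andP[]].
have [nxy [xV yV] wq [uq oq] nr] := ear.
have [R3 pp] := perm3 ups erefl Rps R'ps nRR'.
have thR := theta_in_perm pp th; have oqR := outside_sub (Vsub _ pp) oq.
have sz0 s : (s = [::] -> q <> [::]) -> 0 < size s + size q.
  by case: s => // /(_ erefl); case: (q).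
move: yV; rewrite 2!in_cons => /or3P[/eqP Ey|/eqP Ey|].
- case/splitPr: xR thR oqR Rps {nRR' pp} => r1 r2 thR oqR Rps.
  (* Exchanging the roles of [u] and [v] reduces an ear ending at [u] to one ending at [v]. *)
  have := theta_in_rev thR; rewrite /= rev_cat rev_cons cat_rcons => thR'.
  apply: (same_arc_end_listed thR') uq _ _; first by rewrite -Ey.
    apply: outside_sub oqR => z; rewrite !inE !mem_cat !inE !mem_rev.
    by do ![case: (_ \in _) | case: (_ == _)].
  rewrite size_rev; apply: sz0 => Er1 Eq; have := nr Eq.
  by rewrite rs Ey (@rwalk _ [::] (rcons r2 v) _ _ Rps) // Er1.
- case/splitPr: xR thR oqR Rps {nRR' pp} => r1 r2 thR oqR Rps.
  apply: (same_arc_end_listed thR) uq oqR _; first by rewrite -Ey.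
  apply: sz0 => Er2 Eq; have := nr Eq.
  by rewrite Ey (@rwalk _ (u :: r1) [::] _ _ Rps) // Er2 rcons_cat.
case/flattenP => S Sps yS; case: (eqVneq R S) => [ERS|nRS].
  subst S; case/splitPr: xR thR oqR Rps yS {nRR' pp} => r1 r2 thR oqR Rps.
  rewrite mem_cat inE eq_sym (negbTE nxy) /= => /orP[] yr.
    case/splitPr: yr thR oqR Rps => s1 s2; rewrite -catA cat_cons => thR oqR Rps.
    have [_ _ wq' [uq' _] _] := proper_ear_sym rs ear.
    apply: (same_arc_listed thR wq' uq').
      by rewrite /outside all_rev.
    rewrite size_rev; apply: sz0 => Es2 Eq; have := nr Eq.
    rewrite rs (@rwalk _ (u :: s1) (rcons r2 v) _ _ Rps) // Es2 rcons_cat //.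
  case/splitPr: yr thR oqR Rps => s1 s2 thR oqR Rps.
  apply: (same_arc_listed thR wq uq oqR).
  apply: sz0 => Es1 Eq; have := nr Eq.
  by rewrite (@rwalk _ (u :: r1) (rcons s2 v) _ _ Rps) // Es1 rcons_cat.
(* Only [P] can have more than one inner vertex, so one of two different arcs has just one. *)
have small : (size R == 1) || (size S == 1).
  move: Rps Sps nRS; rewrite !inE => /or3P[/eqP->|/eqP->|/eqP->] // /or3P[/eqP->|/eqP->|/eqP->] //=;
  by rewrite ?eqxx ?orbT.
case/orP: small => s1.
  have [R4 pp4] := perm3 ups erefl Rps Sps nRS.
  have th4 := theta_in_perm pp4 th; have oq4 := outside_sub (Vsub _ pp4) oq.
  have ER : R = [:: x] by case: (R) s1 xR => [|? [|? ?]] //= _; rewrite inE => /eqP->.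
  rewrite ER in th4 oq4; case/splitPr: yS th4 oq4 {Sps nRS pp4} => r1 r2 th4 oq4.
  exact: cross_arcs_listed th4 wq uq oq4.
rewrite eq_sym in nRS; have [R4 pp4] := perm3 ups erefl Sps Rps nRS.
have th4 := theta_in_perm pp4 th; have oq4 := outside_sub (Vsub _ pp4) oq.
have ES : S = [:: y] by case: (S) s1 yS => [|? [|? ?]] //= _; rewrite inE => /eqP->.
have [_ _ wq' [uq' _] _] := proper_ear_sym rs ear.
rewrite ES in th4 oq4; case/splitPr: xR th4 oq4 {Rps nRR' nRS pp pp4 thR oqR} => r1 r2 th4 oq4.
by apply: (cross_arcs_listed th4 wq' uq'); rewrite /outside all_rev.
Qed.

(** The ear is a fourth arc. If both [q] and [P] are long, dropping [[:: b]] leaves a listed theta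
    graph; if exactly one is long, Theta_{2,2,2,2t} contradicts (4:2)-choosability; otherwise
    Theta_{2,2,2,2} appears. *)
Lemma small_theta_outer_ear q : proper_ear V r u v q -> listed.
Proof.
move=> [_ _ wq [uq oq] _]; have /and3P[uV ups wps] := th.
have /and4P[w1 w2 w3 _] := wps.
have oP := small_theta_odd; have oqd : odd (size q) := walks_same_parity wq w1.
have nq : q != [::] by case: (q) oqd.
have th4 : theta_in u v (q :: ps).
  apply/and3P; split.
  - by have uall := outside_uniq uV uq oq; uniq_from uall.
  - rewrite cons_uniq ups andbT; apply/negP => qps.
    have [z zq] : exists z, z \in q.
      by case: (q) nq => [//|z q'] _; exists z; rewrite mem_head.
    have zps : z \in flatten ps by apply/flattenP; exists q.
    by have := allP oq z zq; rewrite 2!in_cons zps !orbT.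
  - by rewrite /= wq.
case: (ltnP 1 (size q)) => sq; case: (ltnP 1 (size P)) => sP.
- have th3 : theta_in u v [:: [:: a]; q; P].
    have /and3P[uq4 ups4 /and5P[wq4 wa wb wP _]] := th4; apply/and3P; split.
    + by uniq_from uq4.
    + move: ups4; rewrite /= !inE !negb_or => /and4P[/and3P[h1 h2 h3] /andP[h4 h5] h6 _].
      by rewrite eq_sym h1 h5 h3.
    + by apply/and4P; split.
  exact: theta1_listed th3 sq sP.
- have th' : theta_in u v [:: [:: a]; [:: b]; P; q].
    by apply: theta_in_perm th4; apply/permPl; apply: (perm_catC [:: q] ps).
  have /and3P[uq' _ _] := th'.
  have [] := @theta_2222t_not_walk_choosable _ u v [:: a] [:: b] P q => //.
    by move: oP sP; case: (size P) => [|[|]].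
  exact: choosable_walk_choosable Gch (theta_in_walks th').
- have th' : theta_in u v [:: [:: a]; [:: b]; q; P].
    by apply: theta_in_perm th4; apply/permPl; apply: (perm_catCA [:: q] [:: [:: a]; [:: b]] [:: P]).
  have /and3P[uq' _ _] := th'.
  have [] := @theta_2222t_not_walk_choosable _ u v [:: a] [:: b] q P => //.
    by move: oqd sq; case: (size q) => [|[|]].
  exact: choosable_walk_choosable Gch (theta_in_walks th').
- have Eq : size q = 1 by move: oqd sq; case: (size q) => [|[|]].
  have EP : size P = 1 by move: oP sP; case: (size P) => [|[|]].
  have /and3P[uq4 ups4 _] := th4.
  apply: Or44; exists u, v, (q :: ps); split=> //; first by rewrite /= Eq EP.
  apply: critical_union_of_walks => //; first exact: theta_in_walks.
  by apply: theta_2222_not_walk_choosable => //; rewrite /shape /= Eq EP.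
Qed.

Lemma small_theta_listed : listed.
Proof.
have rs : symmetric r := @walks_edge_sym _ _.
case: small_theta_ear => // -[x [y [q ear]]].
case: (boolP (x \in flatten ps)) => [xps | nx]; first exact: small_theta_inner_ear xps ear.
case: (boolP (y \in flatten ps)) => [yps | ny].
  exact: small_theta_inner_ear yps (proper_ear_sym rs ear).
have [nxy [xV yV] _ _ _] := ear.
rewrite 2!in_cons (negbTE nx) orbF in xV; rewrite 2!in_cons (negbTE ny) orbF in yV.
move: xV yV nxy ear; case/orP => /eqP->; case/orP => /eqP->; rewrite ?eqxx // => _ ear.
  exact: small_theta_outer_ear ear.
exact: small_theta_outer_ear (proper_ear_sym rs ear).
Qed.

End SmallTheta.

(** Both an ear and a lollipop attached to a single vertex contain a cycle. *)
Lemma critical_has_cycle : exists x c, [/\ walk x (rcons c x), 1 < size c & uniq (x :: c)].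
Proof.
have [x0 _] := critical_inhabited Gcrit.
have ear : ear_spec [:: x0] (fun _ _ => false).
  apply: (ear_exists Gcrit (mem_head x0 [::])) => // C L cL.
  by have [g gL] := default_colouring (isT : 1 <= 2) cL; exists g.
case: ear.
- move=> x y q; rewrite !inE => /eqP-> /eqP-> wq uq oq _ n1; exists x0, q; split=> //.
    case: (q) wq n1 => [|? [|? ?]] //=; first by rewrite edge_irr.
    by move=> _ /(_ erefl); rewrite eqxx.
  rewrite /= uq andbT; apply/negP => xq; have := allP oq _ xq; by rewrite mem_head.
- move=> x q z c _ _ wc uqc _ sc; exists z, c; split=> //.
  by uniq_from uqc.
Qed.

Lemma critical_listed : listed.
Proof.
have [x0 [c0 [w0 s0 u0]]] := critical_has_cycle.
pose s := x0 :: c0.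
have cs : cycle (@edge G) s by [].
pose r x y := (next s x == y) || (next s y == x).
have mem_next' x : (next s x \in s) = (x \in s) := mem_next s x.
have [//|] : listed \/ exists x y q, proper_ear s r x y q.
  apply: (ear_listed (mem_head x0 c0)).
  - by move=> x y xs /orP[] /eqP E; [rewrite -E mem_next' | rewrite -mem_next' E].
  - move=> C L cL; have ec := closed_walk_even_cycle w0 s0.
    have [f fL] := even_cycle_walk_choosable ec u0 cL; rewrite /= andbT => pd.
    have cd : cycle (relpre f (@disj C)) s by rewrite /= -path_map.
    exists f => // x y xs /orP[] /eqP E; first by rewrite -E; apply: (next_cycle cd).
    have ys : y \in s by rewrite -mem_next' E.
    by rewrite disj_sym -E; apply: (next_cycle cd).
  - move=> x xs; have [c [wc uc cE sc _]] := cycle_rooted cs u0 xs; exists c; split=> //.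
      by rewrite sc.
    by move=> z; rewrite cE.
case=> x [y [q [nxy [xs ys] wq [uq oq] nr]]].
have [c [wc uc cE sc nE]] := cycle_rooted cs u0 xs.
have yc : y \in c by move: ys; rewrite -cE inE eq_sym (negbTE nxy).
have oq' : outside (x :: c) q by apply: outside_sub oq => z; rewrite cE.
have uall := outside_uniq uc uq oq'.
rewrite /r -!nE in nr.
case/splitPr: yc wc uc sc nr uall {cE nE oq'} => p1 p2; rewrite walk_cat.
move=> /andP[w1 w2] uc sc nr uall.
(* An ear without inner vertices is a chord and not an edge of the cycle, so it cannot coincide with
   an empty side [p1] or [p2]. *)
have nq1 : p1 = [::] -> q <> [::].
  by move=> E /nr; rewrite E /= !eqxx.
have nq2 : p2 = [::] -> q <> [::].
  move=> E /nr; rewrite E negb_or => /andP[_ /negP[]].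
  rewrite next_nth !inE mem_cat !inE eqxx !orbT /= (negbTE nxy).
  have np1 : y \notin p1.
    by have up : uniq (y :: p1) by [uniq_from uc]; case/andP: up.
  by rewrite index_cat (negbTE np1) /= eqxx addn0 nth_default // size_cat /= addn1.
(* The ends of the ear split the cycle into two arcs; the ear is the third. *)
have th : theta_in x y [:: p1; rev p2; q].
  apply/and3P; split.
  - by uniq_from uall.
  - have sp : 0 < size p1 + size p2.
      have : 1 < size (p1 ++ y :: p2) by rewrite sc.
      by rewrite size_cat /= addnS ltnS.
    have n12 : p1 != rev p2.
      apply/eqP => E; have un : uniq (p1 ++ p2) by uniq_from uc.
      case: (p1) E un sp => [|z p1'] E un sp.
        by move: sp; rewrite -(size_rev p2) -E.
      move: un; rewrite cat_uniq => /and3P[_ /hasPn h _].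
      have /h : z \in p2 by rewrite -mem_rev -E mem_head.
      by rewrite /= mem_head.
    have np s' : (s' = [::] -> q <> [::]) -> {subset s' <= x :: p1 ++ y :: p2} -> s' != q.
      move=> nil sub; apply/eqP => E; case: (q) E nil uall => [|z q'] E nil uall.
        exact: nil E erefl.
      move: uall; rewrite cat_uniq => /and3P[_ /hasPn /(_ z)]; rewrite mem_head => /(_ isT).
      by rewrite /= sub // E mem_head.
    rewrite /= !inE negb_or n12 /= np //=; last first.
      by move=> z zp; rewrite inE mem_cat zp orbT.
    rewrite andbT np //.
      by move=> E; apply: nq2; rewrite -(revK p2) E.
    by move=> z; rewrite mem_rev => zp; rewrite !(inE, mem_cat) zp !orbT.
  - by rewrite /= w1 wq walk_rev.
have [//|[a [b [P thP]]]] := theta_cases (ps := [:: p1; rev p2; q]) erefl th.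
exact: small_theta_listed thP.
Qed.

End Structure.

Theorem theorem1p2 (G : sgraph) (Gcrit : three_choosable_critical G) :
  choosable 4 2 G <->
  [\/ two_even_cycles_joined_by_path G,
      two_even_cycles_sharing_vertex G,
      exists s t : nat, [/\ 1 < s, 1 < t &
        theta [:: 2; 2 * s; 2 * t] G \/
        theta [:: 1; 2 * s - 1; 2 * t - 1] G]
    | theta [:: 2; 2; 2; 2] G].
Proof. by split; [apply: critical_listed | apply: family_choosable]. Qed.
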